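(* Consider explorations (as defined in the context) of a circular route of length $100$ miles, where the Professor is allowed to start at any moment during the day (so that the first ration box he uses may already have been partially consumed, and only the used part of the first day is counted). The minimum possible duration of an exploration is exactly $22\frac{9}{16}$ days: there is an exploration that takes $22\frac{9}{16}$ days, and every exploration takes at least $22\frac{9}{16}$ days.
   Context: The route is a circle of circumference $100$ miles with a distinguished point, the base (starting point). Food comes in sealed ration boxes; one ration box contains food for exactly one day, i.e. for $20$ miles of walking. At the base there is an unlimited supply of sealed boxes; initially there are no boxes elsewhere. The Professor walks along the circle at $20$ miles per day, in either direction, and may turn around at any moment (so miles may be wasted by walking back and forth). He eats continuously while walking, at a rate of one ration per $20$ miles, out of one opened box, the box in use, which he must have with him while walking. He opens (unseals) a new box only when the box in use has been completely consumed; the new box must be at his current position (lying there, or carried by him). He can carry at most two boxes at any time, and the box in use counts as one of them; so while walking he carries at most one sealed box in addition to the box in use. He may drop a sealed box at any point and pick up sealed boxes lying at his current position. Food may not be transferred between boxes. An exploration is such a walk which starts at the base, ends at the base, and visits every point of the circle. Its duration in days is the number of miles walked divided by $20$. If the Professor may start at any moment during the day, the first box in use contains at the start any chosen fraction $s\in(0,1]$ of a ration. The last box in use need not be completely consumed. *)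

(* Defs.v *)
From Stdlib Require Export Reals List.
Export ListNotations.
Open Scope R_scope.

(** Lengths are in miles, food in rations (one ration = one day of walking). *)
Definition circumference : R := 100.
Definition miles_per_day : R := 20.

(** The route is the circle R / 100 Z.  A real number [x] stands for the point
    [x mod 100]; all positions below are such unrolled coordinates, so walking
    [d] miles (signed) from [x] leads to [x + d]. *)
Definition same_point (x y : R) : Prop :=
  exists k : Z, x - y = IZR k * circumference.

Definition base : R := 0.

(** The box in use counts as one of the two boxes that can be carried, so at
    most one sealed box is carried: a boolean records it.  An emptied box stays
    "in use" (with [food] = 0) until the next one is opened; since walking is
    then impossible, and a lying box can be opened without being picked up
    first, letting an empty box occupy its slot is no restriction. *)
Record state := State {
  pos : R;              (* current position *)
  food : R;             (* fraction of a ration left in the box in use *)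
  sealed : bool;        (* is a sealed box being carried? *)
  caches : list R       (* positions of dropped sealed boxes, with multiplicity *)
}.

(** [take_box x l l']: a sealed box lying at the point [x] is taken away, which
    turns the multiset of dropped boxes from [l] into [l'].  The supply at the
    base is unlimited and is not part of these lists. *)
Inductive take_box (x : R) : list R -> list R -> Prop :=
| take_base l : same_point x base -> take_box x l l
| take_cache l1 y l2 :
    same_point x y -> take_box x (l1 ++ y :: l2) (l1 ++ l2).

(** Actions performed without walking. *)
Inductive handle : state -> state -> Prop :=
| pick_up x r l l' :
    take_box x l l' -> handle (State x r false l) (State x r true l')
| drop x r l :
    handle (State x r true l) (State x r false (x :: l))
| open_carried x l :
    handle (State x 0 true l) (State x 1 false l)
| open_lying x c l l' :
    take_box x l l' -> handle (State x 0 c l) (State x 1 c l').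

(** [run s legs s']: a finite succession of actions leads from [s] to [s'];
    [legs] lists the (start, end) pairs of the straight walks in it. *)
Inductive run : state -> list (R * R) -> state -> Prop :=
| run_stop s : run s [] s
| run_handle s s' legs s'' :
    handle s s' -> run s' legs s'' -> run s legs s''
| run_walk x r c l d legs s'' :
    Rabs d <= miles_per_day * r ->
    run (State (x + d) (r - Rabs d / miles_per_day) c l) legs s'' ->
    run (State x r c l) ((x, x + d) :: legs) s''.

Definition miles_walked (legs : list (R * R)) : R :=
  fold_right (fun leg m => Rabs (snd leg - fst leg) + m) 0 legs.

Definition duration (legs : list (R * R)) : R :=
  miles_walked legs / miles_per_day.

Definition visits (legs : list (R * R)) (p : R) : Prop :=
  exists a b q : R,
    In (a, b) legs /\ Rmin a b <= q <= Rmax a b /\ same_point q p.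

(** An exploration whose first box in use initially contains the fraction [s]
    of a ration. *)
Definition exploration (s : R) (legs : list (R * R)) : Prop :=
  0 < s <= 1 /\
  (exists final : state,
     run (State base s false []) legs final /\ same_point (pos final) base) /\
  (forall p : R, visits legs p).

(* Main.v *)
From Pilot Require Import Defs.
From Stdlib Require Import Reals List Lra Lia Permutation ZArith.
(* Reals has its own [pos]; the field of [state] is meant below. *)
Import Pilot.Defs.
Open Scope R_scope.

(** The lower bound is linear programming duality, written as a potential.

    A sealed box at distance x from the base is priced at [2 * w x], where w is
    convex and piecewise linear with slope 1 near the base: bringing the box
    out takes a walk with it and, as a rule, a walk back without it.  The walker
    is priced by plans: carry a box outwards, turn, come back to a place q
    exactly when the box in use is empty.  The price of all boxes plus the
    profit of any plan never exceeds the miles walked so far ([secured]).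
    Walking cannot break this, because w is convex and nondecreasing
    ([covers_walk]); opening a box cannot, provided that prices satisfy the
    dual constraints ([fair]); and at the base everything is free.  The
    weights below are optimal solutions of the dual linear programs.

    The bound is applied on the real line, to which the circle unrolls until
    the visited points close up, at an interval [[lo, hi]] of length 100
    ([closing_split]).  East (positive) and west have separate weights.  One
    side serves for setting out, the other one for the depots of the return.
    On the latter side the walker must go home after laying the depots, which
    costs [4 * P - 40] miles beyond the prices of the boxes, P being the
    deepest place where a box was opened there; the weights [west P] depend
    on P.

    Suppose that the interval closes at its east end, 50 miles or more from the
    base.  If the walker then returns through the east, he has made a round
    trip to both ends, and this is far too long ([east_switch]).  Otherwise he
    lives on eastern boxes until he touches a western one ([touch_west]).  Let
    t be the distance from the base, on the west side, at which his box in use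
    would run out.  A box at distance at least t and another one at distance
    at least t - 20 must be there ([two_boxes_within]), at a price of
    [14 * t - 220 - (4 * P - 40)] or more.  The eastern part costs at least
    [700 - 16 * t] by the weights [east], and at least
    [240 + 96/7 * (115/4 - t)] by the weights [mild].  Together with the last t
    miles this makes 1805/4 miles or more, with equality only at t = 115/4.
    If the interval closes less than 50 miles from the base, a round trip of
    more than 50 miles to the other side has been made, and the same prices
    give more than enough ([closing_west]).

    The tour that attains the bound starts with 1/8 of a ration, lays boxes
    115/4 and 35/4 miles west of the base and returns, in 365/2 miles; sets out
    eastwards and stands after 200 more miles at 125/4 with two boxes; and
    goes home around the circle. *)

(** * Convex weights *)

(** A pair [(k, a)] raises the slope, which is 1 at the base, by [a] at
    distance [k]. *)
Fixpoint weight (hs : list (R * R)) (x : R) : R :=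
  match hs with
  | [] => x
  | (k, a) :: t => a * Rmax 0 (x - k) + weight t x
  end.

(** No kink below 10 miles: up to there the round trip takes one box, and a
    depot costs the bare walk. *)
Definition kinks_ok (hs : list (R * R)) : Prop :=
  Forall (fun h => 10 <= fst h /\ 0 <= snd h) hs.

Lemma weight_short hs x : kinks_ok hs -> x <= 10 -> weight hs x = x.
Proof.
  intros H Hx. induction H as [|[k a] t [Hk Ha] _ IH]; cbn in *; [reflexivity|].
  rewrite Rmax_left by lra. rewrite IH. ring.
Qed.

Lemma hinge_mono k x y : x <= y -> Rmax 0 (x - k) <= Rmax 0 (y - k).
Proof. intros; apply Rle_max_compat_l; lra. Qed.

Lemma weight_mono hs x y : kinks_ok hs -> x <= y -> weight hs x <= weight hs y.
Proof.
  intros H Hxy. induction H as [|[k a] t [Hk Ha] _ IH]; cbn in *; [lra|].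
  pose proof (hinge_mono k x y Hxy). nra.
Qed.

Lemma weight_ge hs x : kinks_ok hs -> x <= weight hs x.
Proof.
  intros H. induction H as [|[k a] t [Hk Ha] _ IH]; cbn in *; [lra|].
  pose proof (Rmax_l 0 (x - k)). nra.
Qed.

Lemma hinge_convex k x m d :
  x <= m -> 0 <= d ->
  Rmax 0 (m - d - k) - Rmax 0 (x - d - k) <= Rmax 0 (m - k) - Rmax 0 (x - k).
Proof.
  intros. unfold Rmax. repeat destruct Rle_dec; lra.
Qed.

Lemma weight_convex hs x m d :
  kinks_ok hs -> x <= m -> 0 <= d ->
  weight hs (m - d) - weight hs (x - d) <= weight hs m - weight hs x.
Proof.
  intros H Hxm Hd. induction H as [|[k a] t [Hk Ha] _ IH]; cbn in *; [lra|].
  pose proof (hinge_convex k x m d Hxm Hd). nra.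
Qed.

(** * Plans and their profit *)

(** One side of the base: its weight, the value [worth q] of a walker who stands
    at distance q with an empty box in use, and a bound on the places where
    boxes are opened. *)
Record side := Side {
  kinks : list (R * R);
  worth : R -> R;
  open_limit : R
}.

Definition value (A : side) (x : R) : R := 2 * weight (kinks A) x.

(** The constraints of the dual program.  [fair_base]: no plan that starts at the
    base with f miles left in the box in use makes a profit.  [fair_open]: after
    opening a box at p, no plan profits by more than the price of that box and
    the worth of the walker at p. *)
Record fair (A : side) : Prop := Fair {
  fair_kinks : kinks_ok (kinks A);
  fair_limit : 0 <= open_limit A;
  fair_home : worth A 0 = 0;
  fair_base : forall q f, 0 <= q <= open_limit A -> q <= f <= 20 ->
    value A ((q + f) / 2) + worth A q <= f;
  fair_open : forall p q, 0 < p <= open_limit A -> 0 <= q <= open_limit A ->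
    Rabs (q - p) <= 20 ->
    value A ((p + q + 20) / 2) + worth A q <= worth A p + 2 * value A p + 20
}.

(** The walker is at distance x and can go f miles with the box in use.  The plan
    for q carries a box out to [(x + q + f) / 2] and returns to q with nothing
    left; its profit is the gain in price and worth less the f miles. *)
Definition covers (A : side) (x f K : R) : Prop :=
  forall q, 0 <= q <= open_limit A -> Rabs (q - x) <= f ->
    value A ((x + q + f) / 2) - value A x + worth A q - f <= K.

Ltac rabs :=
  unfold Rabs in *; repeat destruct Rcase_abs; try lra.

(** An outward step leaves the turning point of each plan where it is; an inward
    step shifts it inwards by as much, which gains no more since the weight is
    convex.  The share b of a sealed box (0 or 1) is carried along. *)
Lemma covers_walk A x x' f b K K' :
  fair A -> 0 <= x -> 0 <= x' -> 0 <= b <= 1 -> Rabs (x' - x) <= f ->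
  covers A x f K ->
  K + Rabs (x' - x) - b * (value A x' - value A x) <= K' ->
  covers A x' (f - Rabs (x' - x)) K'.
Proof.
  intros HA Hx Hx' Hb Hd HK HK' q Hq Hqx.
  pose proof (fair_kinks A HA) as Hk.
  assert (Hqf : Rabs (q - x) <= f) by rabs.
  specialize (HK q Hq Hqf).
  destruct (Rle_dec x x') as [Hxx|Hxx].
  - rewrite (Rabs_pos_eq (x' - x)) in * by lra.
    replace ((x' + q + (f - (x' - x))) / 2) with ((x + q + f) / 2) by lra.
    assert (value A x <= value A x')
      by (unfold value; pose proof (weight_mono _ x x' Hk Hxx); lra).
    nra.
  - rewrite (Rabs_left (x' - x)) in * by lra.
    set (d := x - x'). replace (- (x' - x)) with d in * by (unfold d; lra).
    assert (0 <= d) by (unfold d; lra).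
    assert (Hm : x <= (x + q + f) / 2) by rabs.
    replace ((x' + q + (f - d)) / 2) with ((x + q + f) / 2 - d)
      by (unfold d; field).
    replace x' with (x - d) in * by (unfold d; lra).
    pose proof (weight_convex (kinks A) x _ d Hk Hm H) as Hc.
    assert (value A (x - d) <= value A x)
      by (unfold value; pose proof (weight_mono _ (x - d) x Hk ltac:(lra)); lra).
    unfold value in *. nra.
Qed.

(** The plan that ends at the base breaks even, the weight having slope 1 up to
    10 miles. *)
Lemma covers_home A f K : fair A -> 0 <= f <= 20 -> covers A 0 f K -> 0 <= K.
Proof.
  intros HA Hf HK.
  pose proof (fair_limit A HA).
  specialize (HK 0 ltac:(lra) ltac:(rabs)).
  unfold value in HK. rewrite (fair_home A HA) in HK.
  rewrite !(weight_short (kinks A)) in HK by (try apply fair_kinks; trivial; lra).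
  lra.
Qed.

Lemma home_covers A f K : fair A -> f <= 20 -> 0 <= K -> covers A 0 f K.
Proof.
  intros HA Hf HK q Hq Hqf.
  pose proof (fair_base A HA q f Hq ltac:(rabs)).
  replace ((0 + q + f) / 2) with ((q + f) / 2) by field.
  assert (value A 0 = 0)
    by (unfold value; rewrite weight_short by (try apply fair_kinks; trivial; lra); ring).
  lra.
Qed.

Lemma covers_open A p K :
  fair A -> 0 < p <= open_limit A -> covers A p 0 K ->
  covers A p 20 (K + value A p).
Proof.
  intros HA Hp HK q Hq Hqp.
  specialize (HK p ltac:(lra) ltac:(rabs)).
  replace ((p + p + 0) / 2) with p in HK by field.
  pose proof (fair_open A HA p q Hp Hq Hqp). lra.
Qed.

(** * The potential of a state *)

(** East of the base A applies, west of it B. *)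
Definition price (A B : side) (y : R) : R :=
  if Rle_dec 0 y then value A y else value B (- y).

Definition left_price (B : side) (y : R) : R :=
  if Rle_dec 0 y then 0 else value B (- y).

Definition total (v : R -> R) (l : list R) : R :=
  fold_right (fun y t => v y + t) 0 l.

Definition boxes (s : state) : list R :=
  (if sealed s then [pos s] else []) ++ caches s.

(** A second bound on the eastern cost, for a walker who opens no more boxes
    there: [e z] is charged for being able to reach the point z.  It counts no
    eastern boxes, so [floor_open] must let it be paid by the last one opened. *)
Record floor_ok (A : side) (e : R -> R) : Prop := FloorOk {
  floor_mono : forall x y, x <= y -> e x <= e y;
  floor_base : forall f, 0 <= f <= 20 -> e f <= f;
  floor_open : forall p, 0 < p <= open_limit A ->
    e (p + 20) - 20 <= worth A p + value A p
}.

(** M is the number of miles walked so far, less what has been set aside for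
    round trips.  The total price of the boxes, western ones only in the floor,
    and the profit of every plan are covered by M. *)
Definition secured (A B : side) (e : R -> R) (s : state) (M : R) : Prop :=
  0 <= food s <= 1 /\
  (0 <= pos s ->
     covers A (pos s) (20 * food s) (M - total (price A B) (boxes s)) /\
     e (pos s + 20 * food s) - 20 * food s <= M - total (left_price B) (boxes s)) /\
  (pos s <= 0 ->
     covers B (- pos s) (20 * food s) (M - total (price A B) (boxes s))).

Lemma value_nonneg A x : fair A -> 0 <= x -> 0 <= value A x.
Proof.
  intros HA Hx. pose proof (weight_ge (kinks A) x (fair_kinks A HA)).
  unfold value. lra.
Qed.

Lemma value_mono A x y : fair A -> x <= y -> value A x <= value A y.
Proof.
  intros HA Hxy. pose proof (weight_mono (kinks A) x y (fair_kinks A HA) Hxy).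
  unfold value. lra.
Qed.

Lemma value_0 A : fair A -> value A 0 = 0.
Proof.
  intros HA. unfold value.
  rewrite weight_short by (try apply fair_kinks; trivial; lra). ring.
Qed.

Lemma price_right A B y : 0 <= y -> price A B y = value A y.
Proof. intros; unfold price; destruct Rle_dec; [reflexivity | lra]. Qed.

Lemma price_left A B y : fair A -> fair B -> y <= 0 -> price A B y = value B (- y).
Proof.
  intros HA HB Hy; unfold price; destruct Rle_dec; [|reflexivity].
  replace y with 0 by lra. rewrite Ropp_0, !value_0; trivial.
Qed.

Lemma left_price_right B y : 0 <= y -> left_price B y = 0.
Proof. intros; unfold left_price; destruct Rle_dec; [reflexivity | lra]. Qed.

Lemma price_0 A B : fair A -> price A B 0 = 0.
Proof. intros HA. rewrite price_right by lra. apply value_0, HA. Qed.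

Lemma left_price_le A B y : fair A -> fair B -> 0 <= left_price B y <= price A B y.
Proof.
  intros HA HB. unfold left_price, price. destruct Rle_dec.
  - pose proof (value_nonneg A y HA ltac:(lra)). lra.
  - pose proof (value_nonneg B (- y) HB ltac:(lra)). lra.
Qed.

Lemma total_app v l l' : total v (l ++ l') = total v l + total v l'.
Proof. unfold total. induction l as [|y l IH]; cbn; lra. Qed.

Lemma total_perm v l l' : Permutation l l' -> total v l = total v l'.
Proof. unfold total. induction 1; cbn in *; lra. Qed.

Lemma total_nonneg v l : (forall y, 0 <= v y) -> 0 <= total v l.
Proof. intros H. unfold total. induction l as [|y l IH]; cbn; [lra|]. specialize (H y). lra. Qed.

Lemma total_le v w l : (forall y, v y <= w y) -> total v l <= total w l.
Proof. intros H. unfold total. induction l as [|y l IH]; cbn; [lra|]. specialize (H y). lra. Qed.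

Definition carried (v : R -> R) (s : state) : R := if sealed s then v (pos s) else 0.

Lemma total_boxes v s : total v (boxes s) = carried v s + total v (caches s).
Proof.
  unfold boxes, carried. rewrite total_app. destruct (sealed s); cbn; lra.
Qed.

(** On the unrolled line, as long as the visited points have not closed up, a box
    is at the walker's point only if the coordinates agree, and the base is 0. *)
Definition line_take (x : R) (l l' : list R) : Prop :=
  (x = 0 /\ l' = l) \/ Permutation l (x :: l').

(** Boxes are opened no farther west than P. *)
Inductive line_handle (P : R) : state -> state -> Prop :=
| line_pick_up x r l l' :
    line_take x l l' -> line_handle P (State x r false l) (State x r true l')
| line_drop x r l :
    line_handle P (State x r true l) (State x r false (x :: l))
| line_open_carried x l :
    - P <= x -> line_handle P (State x 0 true l) (State x 1 false l)
| line_open_lying x c l l' :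
    - P <= x -> line_take x l l' ->
    line_handle P (State x 0 c l) (State x 1 c l').

Lemma total_take v x l l' : v 0 = 0 -> line_take x l l' -> total v l = v x + total v l'.
Proof.
  intros Hv [[-> ->]|H]; [lra|]. rewrite (total_perm v _ _ H). reflexivity.
Qed.

(** Only an opening changes the total, by the box that it removes; taking a box
    from the supply at the base counts as taking one of price 0. *)
Lemma line_handle_cases P s s' :
  line_handle P s s' ->
  pos s' = pos s /\
  ((food s' = food s /\
    forall v, v 0 = 0 -> total v (boxes s') = total v (boxes s)) \/
   (food s = 0 /\ food s' = 1 /\ - P <= pos s /\
    forall v, v 0 = 0 -> total v (boxes s) = v (pos s) + total v (boxes s'))).
Proof.
  destruct 1 as [x r l l' Ht|x r l|x l Hx|x c l l' Hx Ht];
    cbn [pos food]; split; trivial.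
  - left; split; trivial. intros v Hv. rewrite !total_boxes; unfold carried; cbn [pos sealed caches].
    rewrite (total_take v x l l' Hv Ht). lra.
  - left; split; trivial. 
  - right; repeat split; trivial.
  - right; repeat split; trivial. intros v Hv. rewrite !total_boxes; unfold carried; cbn [pos sealed caches].
    rewrite (total_take v x l l' Hv Ht). destruct c; lra.
Qed.

Section TwoSides.
Variables A B : side.
Variable e : R -> R.
Hypothesis (HA : fair A) (HB : fair B) (He : floor_ok A e).

Lemma left_total_le l : total (left_price B) l <= total (price A B) l.
Proof. apply total_le. intros y. apply left_price_le; trivial. Qed.

Lemma price_nonneg y : 0 <= price A B y.
Proof. pose proof (left_price_le A B y HA HB). lra. Qed.

Lemma left_price_nonneg y : 0 <= left_price B y.
Proof. pose proof (left_price_le A B y HA HB). lra. Qed.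

Lemma secured_base s M :
  pos s = 0 -> 0 <= food s <= 1 ->
  total (price A B) (boxes s) <= M -> secured A B e s M.
Proof.
  intros Hp Hf HM. pose proof (left_total_le (boxes s)).
  split; [trivial|]. rewrite Hp. split; intros _.
  - split; [apply home_covers; trivial; lra|].
    replace (0 + 20 * food s) with (20 * food s) by ring.
    pose proof (floor_base A e He (20 * food s) ltac:(lra)). lra.
  - rewrite Ropp_0. apply home_covers; trivial; lra.
Qed.

Lemma secured_at_base s M :
  pos s = 0 -> secured A B e s M -> total (price A B) (boxes s) <= M.
Proof.
  intros Hp (Hf & HR & _). rewrite Hp in HR.
  destruct (HR ltac:(lra)) as [HR' _].
  apply covers_home in HR'; trivial; lra.
Qed.

Lemma secured_handle P s s' M :
  P <= open_limit B -> pos s <= open_limit A ->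
  line_handle P s s' -> secured A B e s M -> secured A B e s' M.
Proof.
  intros HP Hlim Hh Hs.
  destruct (line_handle_cases _ _ _ Hh) as [Hp [[Hf HT]|(Hf0 & Hf1 & HPx & HT)]].
  - destruct Hs as (Hf' & HR & HL). unfold secured.
    rewrite Hp, Hf, !HT; auto using price_0, left_price_right.
    apply left_price_right; lra.
  - pose proof (HT _ (price_0 A B HA)) as HTp.
    pose proof (HT (left_price B) (left_price_right B 0 ltac:(lra))) as HTl.
    pose proof (left_total_le (boxes s')) as Hle.
    destruct (Rtotal_order (pos s) 0) as [Hn|[Hz|Hpos]].
    + destruct Hs as (Hf & _ & HL). split; [lra|]. rewrite Hp, Hf1.
      split; [lra|]. intros _. rewrite Hf0, Rmult_0_r in HL.
      specialize (HL ltac:(lra)).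
      apply covers_open in HL; trivial; [|lra].
      rewrite Rmult_1_r.
      rewrite price_left in HTp; trivial; [|lra].
      replace (M - total (price A B) (boxes s'))
        with (M - total (price A B) (boxes s) + value B (- pos s)) by lra.
      exact HL.
    + apply secured_base; [lra|lra|].
      pose proof (secured_at_base s M Hz Hs).
      rewrite Hz, price_0 in HTp; trivial. lra.
    + destruct Hs as (Hf & HR & _). split; [lra|]. rewrite Hp, Hf1.
      split; [|lra]. intros _. rewrite Hf0, Rmult_0_r in HR.
      destruct (HR ltac:(lra)) as [HR' _].
      rewrite price_right in HTp by lra. rewrite Rmult_1_r.
      split.
      * pose proof (covers_open A (pos s) _ HA ltac:(lra) HR') as Hc.
        replace (M - total (price A B) (boxes s'))
          with (M - total (price A B) (boxes s) + value A (pos s)) by lra.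
        exact Hc.
      * specialize (HR' (pos s) ltac:(lra) ltac:(rabs)).
        replace ((pos s + pos s + 0) / 2) with (pos s) in HR' by field.
        pose proof (floor_open A e He (pos s) ltac:(lra)). lra.
Qed.

Definition walked (s : state) (d : R) : state :=
  State (pos s + d) (food s - Rabs d / 20) (sealed s) (caches s).

Lemma total_walked v s d :
  total v (boxes (walked s d)) =
  total v (boxes s) + (if sealed s then 1 else 0) * (v (pos s + d) - v (pos s)).
Proof.
  rewrite !total_boxes. unfold carried, walked; cbn [pos sealed caches].
  destruct (sealed s); lra.
Qed.

Lemma secured_walk_right s d M :
  0 <= pos s -> 0 <= pos s + d -> Rabs d <= 20 * food s ->
  secured A B e s M ->
  0 <= food (walked s d) <= 1 /\
  covers A (pos s + d) (20 * food (walked s d))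
    (M + Rabs d - total (price A B) (boxes (walked s d))) /\
  e (pos s + d + 20 * food (walked s d)) - 20 * food (walked s d)
    <= M + Rabs d - total (left_price B) (boxes (walked s d)).
Proof.
  intros Hx Hx' Hd (Hf & HR & _). destruct (HR Hx) as [HR1 HR2].
  set (s' := walked s d).
  assert (Hf' : 20 * food s' = 20 * food s - Rabs d) by (unfold s'; cbn; field).
  pose proof (Rabs_pos d).
  assert (Hb : 0 <= (if sealed s then 1 else 0) <= 1) by (destruct (sealed s); lra).
  split; [lra|split].
  - rewrite Hf'. replace d with (pos s + d - pos s) at 2 by ring.
    eapply covers_walk with (x := pos s) (b := if sealed s then 1 else 0);
      [trivial|trivial|trivial|trivial| |exact HR1|].
    + replace (pos s + d - pos s) with d by ring. trivial.
    + unfold s'. rewrite total_walked, !price_right by lra.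
      replace (pos s + d - pos s) with d by ring. lra.
  - unfold s' at 3. rewrite total_walked, !left_price_right by lra.
    rewrite Hf'.
    assert (e (pos s + d + (20 * food s - Rabs d)) <= e (pos s + 20 * food s)).
    { apply (floor_mono A e He). pose proof (Rle_abs d). lra. }
    lra.
Qed.

Lemma secured_walk_left s d M :
  pos s <= 0 -> pos s + d <= 0 -> Rabs d <= 20 * food s ->
  secured A B e s M ->
  0 <= food (walked s d) <= 1 /\
  covers B (- (pos s + d)) (20 * food (walked s d))
    (M + Rabs d - total (price A B) (boxes (walked s d))).
Proof.
  intros Hx Hx' Hd (Hf & _ & HL). specialize (HL Hx).
  set (s' := walked s d).
  assert (Hf' : 20 * food s' = 20 * food s - Rabs d) by (unfold s'; cbn; field).
  pose proof (Rabs_pos d).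
  assert (Hd' : Rabs (- (pos s + d) - - pos s) = Rabs d)
    by (rewrite <- (Rabs_Ropp d); f_equal; ring).
  assert (Hb : 0 <= (if sealed s then 1 else 0) <= 1) by (destruct (sealed s); lra).
  split; [lra|].
  rewrite Hf'. rewrite <- Hd' at 1.
  eapply covers_walk with (x := - pos s) (b := if sealed s then 1 else 0);
    [trivial|lra|lra|trivial| |exact HL|].
  - lra.
  - unfold s'. rewrite total_walked, !price_left by (trivial; lra). lra.
Qed.

Lemma secured_walk_same s d M :
  (0 <= pos s /\ 0 <= pos s + d) \/ (pos s <= 0 /\ pos s + d <= 0) ->
  Rabs d <= 20 * food s ->
  secured A B e s M -> secured A B e (walked s d) (M + Rabs d).
Proof.
  intros [[Hx Hx']|[Hx Hx']] Hd Hs.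
  - destruct (secured_walk_right s d M Hx Hx' Hd Hs) as (Hf & H1 & H2).
    destruct (Req_dec (pos s + d) 0) as [Hz|Hz].
    + apply secured_base; trivial.
      rewrite Hz in H1. apply covers_home in H1; trivial; lra.
    + split; [trivial|]. cbn [pos walked]. split; [auto|lra].
  - destruct (secured_walk_left s d M Hx Hx' Hd Hs) as (Hf & H1).
    destruct (Req_dec (pos s + d) 0) as [Hz|Hz].
    + apply secured_base; trivial.
      rewrite Hz, Ropp_0 in H1. apply covers_home in H1; trivial; lra.
    + split; [trivial|]. cbn [pos walked]. split; [lra|auto].
Qed.

(** A walk across the base is split there: what crosses is a walker of worth at
    least 0, for whom the other side offers no profit. *)
Lemma secured_walk s d M :
  Rabs d <= 20 * food s ->
  secured A B e s M -> secured A B e (walked s d) (M + Rabs d).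
Proof.
  intros Hd Hs.
  destruct (Rle_dec 0 (pos s * (pos s + d))) as [Hsame|Hcross].
  - apply secured_walk_same; trivial.
    destruct (Rle_dec 0 (pos s)) as [H1|H1], (Rle_dec 0 (pos s + d)) as [H2|H2].
    + left; lra.
    + destruct (Req_dec (pos s) 0); [right; lra | exfalso; nra].
    + destruct (Req_dec (pos s + d) 0); [right; lra | exfalso; nra].
    + right; lra.
  - assert (Hsplit : Rabs d = Rabs (- pos s) + Rabs (pos s + d)).
    { destruct (Rle_dec 0 (pos s)), (Rle_dec 0 (pos s + d)); try (exfalso; nra); rabs. }
    pose proof (Rabs_pos (pos s + d)). pose proof (Rabs_pos (- pos s)).
    assert (H1 : secured A B e (walked s (- pos s)) (M + Rabs (- pos s))).
    { apply secured_walk_same; trivial; [|lra].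
      destruct (Rle_dec 0 (pos s)); [left|right]; lra. }
    assert (H2 : secured A B e (walked (walked s (- pos s)) (pos s + d))
                   (M + Rabs (- pos s) + Rabs (pos s + d))).
    { apply secured_walk_same; trivial; cbn; [|lra].
      destruct (Rle_dec 0 (pos s + d)); [left|right]; lra. }
    replace (M + Rabs d) with (M + Rabs (- pos s) + Rabs (pos s + d)) by lra.
    replace (walked s d) with (walked (walked s (- pos s)) (pos s + d)); trivial.
    unfold walked; cbn. f_equal; lra.
Qed.

End TwoSides.

(** * Runs on the unrolled line *)

Inductive line_run (lo hi P : R) : state -> R -> state -> Prop :=
| line_stop s : lo <= pos s <= hi -> line_run lo hi P s 0 s
| line_step_handle s s' M s'' :
    lo <= pos s <= hi -> line_handle P s s' ->
    line_run lo hi P s' M s'' -> line_run lo hi P s M s''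
| line_step_walk s d M s'' :
    lo <= pos s <= hi -> Rabs d <= 20 * food s ->
    line_run lo hi P (walked s d) M s'' -> line_run lo hi P s (Rabs d + M) s''.

Lemma line_run_app lo hi P s M s' M' s'' :
  line_run lo hi P s M s' -> line_run lo hi P s' M' s'' ->
  line_run lo hi P s (M + M') s''.
Proof.
  induction 1; intros H2.
  - rewrite Rplus_0_l; trivial.
  - eapply line_step_handle; eauto.
  - rewrite Rplus_assoc. eapply line_step_walk; eauto.
Qed.

Lemma line_handle_mono P P' s s' :
  P <= P' -> line_handle P s s' -> line_handle P' s s'.
Proof. intros HP; destruct 1; constructor; trivial; lra. Qed.

Lemma line_run_mono lo hi P P' s M s' :
  P <= P' -> line_run lo hi P s M s' -> line_run lo hi P' s M s'.
Proof.
  intros HP; induction 1.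
  - constructor; trivial.
  - eapply line_step_handle; eauto using line_handle_mono.
  - eapply line_step_walk; eauto.
Qed.

Lemma line_run_invariant (I : state -> Prop) lo hi P s M s' :
  (forall s s', line_handle P s s' -> I s -> I s') ->
  (forall s d, Rabs d <= 20 * food s -> I s -> I (walked s d)) ->
  line_run lo hi P s M s' -> I s -> I s'.
Proof. intros Hh Hw; induction 1; eauto. Qed.

Lemma secured_line_run A B e lo hi P s M s' m :
  fair A -> fair B -> floor_ok A e ->
  P <= open_limit B -> hi <= open_limit A ->
  line_run lo hi P s M s' -> secured A B e s m -> secured A B e s' (m + M).
Proof.
  intros HA HB He HP Hhi H. revert m. induction H; intros m Hs.
  - rewrite Rplus_0_r; trivial.
  - apply IHline_run. eapply secured_handle; eauto. lra.
  - rewrite <- Rplus_assoc. apply IHline_run. apply secured_walk; trivial.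
Qed.

(** The western weights are chosen with the deepest opening P in mind, so the run
    is cut where that opening takes place: there the worth changes from that of
    an outbound to that of a homebound walker. *)
Definition opens_at (P lo hi : R) (s : state) (M : R) (s' : state) : Prop :=
  exists sP M1 M2,
    line_run lo hi P s M1 sP /\ pos sP = - P /\ food sP = 0 /\
    line_run lo hi P sP M2 s' /\ M = M1 + M2.

(** Depths below 10 are rounded up to 10, where outbound and homebound worth
    agree. *)
Lemma line_run_deepest lo hi P0 s M s' :
  line_run lo hi P0 s M s' ->
  exists P, 10 <= P /\ line_run lo hi P s M s' /\
    (P = 10 \/ opens_at P lo hi s M s').
Proof.
  induction 1 as [s Hs|s s' M s'' Hs Hh Hr IH|s d M s'' Hs Hd Hr IH].
  - exists 10. repeat split; [lra|constructor; trivial|left; trivial].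
  - destruct IH as (P & HP & HrP & Hatt).
    assert (Hkeep : line_handle P s s' -> exists P, 10 <= P /\
      line_run lo hi P s M s'' /\ (P = 10 \/ opens_at P lo hi s M s'')).
    { intros HhP. exists P. split; [trivial|split].
      - eapply line_step_handle; eauto.
      - destruct Hatt as [?|(sP & M1 & M2 & Ha & Hb & Hc & Hd' & He)]; [left; trivial|].
        right. exists sP, M1, M2. repeat split; trivial.
        eapply line_step_handle; eauto. }
    destruct (Rle_dec (- pos s) P) as [Hle|Hgt].
    + apply Hkeep. destruct Hh; cbn in Hle; constructor; trivial; lra.
    + destruct (line_handle_cases _ _ _ Hh) as [Hp [[Hf HT]|(Hf0 & _)]].
      * apply Hkeep. destruct Hh; cbn in *; constructor; trivial; lra.
      * exists (- pos s). split; [lra|].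
        assert (Hwhole : line_run lo hi (- pos s) s M s'').
        { eapply line_step_handle; [trivial| |eapply line_run_mono; [|exact HrP]; lra].
          destruct Hh; cbn in *; constructor; trivial; lra. }
        split; [exact Hwhole|right].
        exists s, 0, M. repeat split; trivial; try lra.
        constructor; trivial.
  - destruct IH as (P & HP & HrP & Hatt).
    exists P. split; [trivial|split].
    + apply line_step_walk; trivial.
    + destruct Hatt as [?|(sP & M1 & M2 & Ha & Hb & Hc & Hd' & ->)]; [left; trivial|].
      right. exists sP, (Rabs d + M1), M2. repeat split; trivial; [|lra].
      apply line_step_walk; trivial.
Qed.

Lemma line_run_deepest2 lo hi P0 s M sm M' s' :
  line_run lo hi P0 s M sm -> line_run lo hi P0 sm M' s' ->
  exists P, 10 <= P /\ line_run lo hi P s M sm /\ line_run lo hi P sm M' s' /\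
    (P = 10 \/ opens_at P lo hi s M sm \/ opens_at P lo hi sm M' s').
Proof.
  intros H1 H2.
  destruct (line_run_deepest _ _ _ _ _ _ H1) as (P1 & HP1 & Hr1 & Ha1).
  destruct (line_run_deepest _ _ _ _ _ _ H2) as (P2 & HP2 & Hr2 & Ha2).
  destruct (Rle_dec P1 P2) as [Hle|Hgt].
  - exists P2. repeat split; trivial; [eapply line_run_mono; eauto|].
    destruct Ha2; auto.
  - exists P1. repeat split; trivial; [eapply line_run_mono; [|eauto]; lra|].
    destruct Ha1; auto.
Qed.

(** The box in use was opened no farther west than P, and lasts for 20 miles from
    there. *)
Definition within_left (P : R) (s : state) : Prop :=
  0 <= food s <= 1 /\ (pos s < 0 -> - pos s + 20 * food s <= P + 20).

Lemma within_left_run lo hi P s M s' :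
  0 <= P -> line_run lo hi P s M s' -> within_left P s -> within_left P s'.
Proof.
  intros HP. apply line_run_invariant.
  - intros s1 s2 Hh [Hf H].
    destruct (line_handle_cases _ _ _ Hh) as [Hp [[Hf' _]|(_ & Hf' & Hx & _)]];
      split; rewrite ?Hp, ?Hf'; trivial; lra.
  - intros s1 d Hd [Hf H]. unfold within_left, walked; cbn.
    pose proof (Rabs_pos d). split; [lra|]. intros Hx.
    destruct (Rlt_dec (pos s1) 0) as [Hn|Hn]; [specialize (H Hn)|]; rabs.
Qed.

(** A western point a that has been visited is at most 10 miles beyond P once the
    walker is back: the box that took him there was opened, and the next one will
    be, at depth P or less. *)
Definition reached_left (P a : R) (s : state) : Prop :=
  0 <= food s <= 1 /\
  (a <= P + 10 \/ (pos s < 0 /\ 2 * a <= P + 20 - pos s - 20 * food s)).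

Lemma reached_left_run lo hi P a s M s' :
  0 <= P -> line_run lo hi P s M s' -> reached_left P a s -> reached_left P a s'.
Proof.
  intros HP. apply line_run_invariant.
  - intros s1 s2 Hh [Hf H].
    destruct (line_handle_cases _ _ _ Hh) as [Hp [[Hf' _]|(Hf0 & Hf' & Hx & _)]];
      split; rewrite ?Hp, ?Hf' in *; trivial; try lra.
  - intros s1 d Hd [Hf H]. unfold reached_left, walked; cbn.
    pose proof (Rabs_pos d). split; [lra|].
    destruct H as [H|[Hn H]]; [left; trivial|].
    destruct (Rlt_dec (pos s1 + d) 0) as [Hn'|Hn']; [right|left]; rabs.
Qed.

Lemma price_kinks A A' B B' : kinks A' = kinks A -> kinks B' = kinks B ->
  forall l, total (price A' B') l = total (price A B) l.
Proof.
  intros HA HB l. unfold total. induction l as [|y l IH]; cbn; [reflexivity|].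
  rewrite IH. unfold price, value. rewrite HA, HB. reflexivity.
Qed.

Lemma secured_switch_left A B B' e s M W :
  kinks B' = kinks B -> pos s < 0 ->
  (forall K, covers B (- pos s) (20 * food s) K ->
             covers B' (- pos s) (20 * food s) (K - W)) ->
  secured A B e s M -> secured A B' e s (M - W).
Proof.
  intros Hk Hx Hc (Hf & _ & HL). split; [trivial|]. split; [lra|]. intros _.
  rewrite (price_kinks A A B B'); trivial.
  replace (M - W - total (price A B) (boxes s))
    with (M - total (price A B) (boxes s) - W) by ring.
  apply Hc, HL; lra.
Qed.

Lemma secured_switch_right A A' B e e' s M W :
  kinks A' = kinks A -> 0 < pos s ->
  (forall K, covers A (pos s) (20 * food s) K ->
             covers A' (pos s) (20 * food s) (K - W)) ->
  e' (pos s + 20 * food s) + W <= e (pos s + 20 * food s) ->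
  secured A B e s M -> secured A' B e' s (M - W).
Proof.
  intros Hk Hx Hc He (Hf & HR & _). destruct (HR ltac:(lra)) as [H1 H2].
  split; [trivial|]. split; [|lra]. intros _.
  rewrite (price_kinks A A' B B); trivial.
  split; [|lra].
  replace (M - W - total (price A B) (boxes s))
    with (M - total (price A B) (boxes s) - W) by ring.
  apply Hc, H1.
Qed.

(** * Optimal weights *)

(** The weights of this part are optimal dual solutions of the linear programs
    that minimise the walking needed to stand in the east, with two full boxes,
    far enough out to reach the western depots. *)
Definition east_kinks : list (R * R) := [(10, 1); (20, 2/3); (25, 8/3)].

Definition east : side := Side east_kinks
  (fun p => Rmax (Rmin (- 2 * p) (Rmin (- (8/3) * p + 20/3) (- (16/3) * p + 60)))
                 (16/3 * p - 420)) 200.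

Definition east_floor (z : R) : R := 16 * z - 900.

(** Worth of a walker who returns to the base through the east; the price of the
    boxes is unchanged. *)
Definition east_home : side := Side east_kinks
  (fun p => Rmin (- 2 * p) (Rmin (- (16/3) * p + 100/3) (- 16 * p + 300))) 200.

Definition no_floor (_ : R) : R := - 10000.

(** A second optimal solution of the same program.  The cost as a function of the
    distance has a corner at the optimum, and [mild] gives the smaller of the
    two slopes there. *)
Definition mild : side := Side [(10, 5/7); (15, 4/7); (45/2, 16/7)]
  (fun p => Rmax (Rmin (- (12/7) * p) (Rmin (- (16/7) * p + 40/7) (- (32/7) * p + 40)))
                 (32/7 * p - 2440/7)) 200.

Definition mild_floor (z : R) : R := 240 + 96/7 * (z - 285/4).

(** [P / 2 + 15] is the turning point of the plan that joins openings at the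
    depths P and 10. *)
Definition west_kinks (P : R) : list (R * R) := [(10, 1); (P / 2 + 15, 4)].

Definition west (P : R) : side := Side (west_kinks P) (fun p => - 2 * p) P.

Definition west_home (P : R) : side :=
  Side (west_kinks P) (fun p => Rmin (- 2 * p) (40 - 6 * p)) P.

Lemma Rmax_cases a b : (Rmax a b = a /\ b <= a) \/ (Rmax a b = b /\ a <= b).
Proof. unfold Rmax; destruct Rle_dec; [right|left]; lra. Qed.

Lemma Rmin_cases a b : (Rmin a b = a /\ a <= b) \/ (Rmin a b = b /\ b <= a).
Proof. unfold Rmin; destruct Rle_dec; [left|right]; lra. Qed.

Ltac bound_hinges x :=
  repeat match goal with
  | |- context [Rmax 0 (x - ?k)] =>
      let h := fresh "h" in
      pose proof (Rmax_l 0 (x - k)); pose proof (Rmax_r 0 (x - k));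
      set (h := Rmax 0 (x - k)) in *; clearbody h
  end.
Ltac unfold_side :=
  unfold value; cbn [kinks worth open_limit weight east_kinks west_kinks
                     east east_home mild west west_home].

Ltac mins :=
  repeat match goal with
  | |- context [Rmin ?a ?b] =>
      lazymatch a with context [Rmin] => fail | _ =>
      lazymatch b with context [Rmin] => fail | _ =>
      destruct (Rmin_cases a b) as [[-> ?]|[-> ?]] end end
  end.
Ltac maxs :=
  repeat match goal with
  | |- context [Rmax ?a ?b] =>
      lazymatch a with context [Rmin] => fail | _ =>
      destruct (Rmax_cases a b) as [[-> ?]|[-> ?]] end
  end.

Ltac prove_fair :=
  constructor;
  [ repeat constructor; cbn; lra
  | cbn; lra
  | cbn; mins; maxs; lra
  | unfold_side; intros q f Hq Hf; mins; maxs; lra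
  | unfold_side; intros p q Hp Hq Hd;
    assert (- 20 <= q - p <= 20) by rabs; clear Hd; bound_hinges p;
    let m := fresh "m" in
    set (m := (p + q + 20) / 2);
    assert (2 * m = p + q + 20) by (unfold m; field); clearbody m;
    mins; maxs; lra ].

Lemma east_fair : fair east.
Proof. prove_fair. Qed.

Lemma east_home_fair : fair east_home.
Proof. prove_fair. Qed.

Lemma mild_fair : fair mild.
Proof. prove_fair. Qed.

Lemma west_fair P : 10 <= P -> fair (west P).
Proof. intros HP. prove_fair. Qed.

Lemma west_home_fair P : 10 <= P -> fair (west_home P).
Proof. intros HP. prove_fair. Qed.

Ltac prove_floor :=
  constructor;
  [ intros x y Hxy; unfold east_floor, mild_floor, no_floor; lra
  | intros f Hf; unfold east_floor, mild_floor, no_floor; lra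
  | unfold_side; intros p Hp; unfold east_floor, mild_floor, no_floor; bound_hinges p;
    mins; maxs; lra ].

Lemma east_floor_ok : floor_ok east east_floor.
Proof. prove_floor. Qed.

Lemma east_home_floor_ok : floor_ok east_home no_floor.
Proof. prove_floor. Qed.

Lemma mild_floor_ok : floor_ok mild mild_floor.
Proof. prove_floor. Qed.

(** The round trip down to P pays [4 * P - 40]: this is the difference between
    the worth of an outbound and of a homebound walker at P. *)
Lemma west_switch P K :
  10 <= P -> covers (west P) P 0 K -> covers (west_home P) P 0 (K - (4 * P - 40)).
Proof.
  intros HP H q Hq Hd. assert (q = P) by rabs. subst q.
  specialize (H P Hq Hd). unfold_side. revert H. unfold_side. intros H.
  replace ((P + P + 0) / 2) with P in * by field.
  pose proof (Rmin_r (- 2 * P) (40 - 6 * P)). lra.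
Qed.

Lemma east_value_far x : 25 <= x -> value east x = 32/3 * x - 180.
Proof. intros Hx. unfold_side. rewrite !Rmax_right by lra. lra. Qed.

(** At the far end of an eastern round trip, compare the plans: an outbound walker
    can go on to [b + f], where he is worth at least the last piece of
    [worth east]; a homebound one does best by turning back at once. *)
Lemma east_switch b f K :
  50 <= b <= 100 -> 0 <= f <= 20 -> covers east b f K ->
  covers east_home b f (K - (64/3 * b - 720)).
Proof.
  intros Hb Hf H q Hq Hd.
  specialize (H (b + f) ltac:(cbn; lra) ltac:(rabs)).
  assert (b - f <= q) by rabs.
  change (value east_home) with (value east).
  rewrite !east_value_far in * by lra.
  revert H. cbn [worth east east_home]. intros H.
  pose proof (Rmax_r (Rmin (- 2 * (b + f))
    (Rmin (- (8/3) * (b + f) + 20/3) (- (16/3) * (b + f) + 60)))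
    (16/3 * (b + f) - 420)).
  pose proof (Rmin_r (- 2 * q) (Rmin (- (16/3) * q + 100/3) (- 16 * q + 300))).
  pose proof (Rmin_r (- (16/3) * q + 100/3) (- 16 * q + 300)).
  lra.
Qed.

(** * Boxes that the way home requires *)

(** Distances on the circle: [far d x] says that x is more than d miles away from
    the base. *)
Definition near (d x y : R) : Prop := exists k : Z, Rabs (x - y - IZR k * 100) <= d.
Definition far (d x : R) : Prop := forall k : Z, d < Rabs (x - IZR k * 100).

Definition has_one (Q : R -> Prop) (l : list R) : Prop := exists y, In y l /\ Q y.

Definition has_two (Q1 Q2 : R -> Prop) (l : list R) : Prop :=
  exists y1 y2 l', Permutation l (y1 :: y2 :: l') /\ Q1 y1 /\ Q2 y2.

(** Two distinct boxes of a list survive the replacement of one entry, as when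
    the carried box moves. *)
Lemma has_two_change (Q1 Q2 Q1' Q2' : R -> Prop) x y l :
  (forall z, Q1' z -> Q1 z) -> (forall z, Q2' z -> Q2 z) ->
  (Q1' x -> Q1 y) -> (Q2' x -> Q2 y) ->
  has_two Q1' Q2' (x :: l) -> has_two Q1 Q2 (y :: l).
Proof.
  intros H1 H2 H1x H2x (y1 & y2 & l' & HP & Hy1 & Hy2).
  assert (Hin : In x (y1 :: y2 :: l')) by (eapply Permutation_in; [exact HP|left; trivial]).
  destruct Hin as [->|[->|Hin]].
  - apply Permutation_cons_inv in HP. exists y, y2, l'. auto.
  - assert (HP' : Permutation l (y1 :: l')).
    { eapply Permutation_cons_inv. rewrite HP. apply perm_swap. }
    exists y1, y, l'. split; [|auto]. rewrite HP'. apply perm_swap.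
  - apply in_split in Hin. destruct Hin as (a & b & ->).
    assert (HP' : Permutation l (y1 :: y2 :: a ++ b)).
    { eapply (Permutation_cons_inv (a := x)). rewrite HP.
      symmetry. exact (Permutation_middle (y1 :: y2 :: a) b x). }
    exists y1, y2, (y :: a ++ b). split; [|auto]. rewrite HP'.
    exact (Permutation_middle [y1; y2] (a ++ b) y).
Qed.

Lemma has_two_weaken (Q1 Q2 Q1' Q2' : R -> Prop) l :
  (forall z, Q1' z -> Q1 z) -> (forall z, Q2' z -> Q2 z) ->
  has_two Q1' Q2' l -> has_two Q1 Q2 l.
Proof. intros H1 H2 (y1 & y2 & l' & HP & ?); exists y1, y2, l'; intuition. Qed.

Lemma near_same d x y : 0 <= d -> same_point x y -> near d x y.
Proof.
  intros Hd [k Hk]. exists k. unfold circumference in Hk. rewrite Hk.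
  replace (IZR k * 100 - IZR k * 100) with 0 by ring. rewrite Rabs_R0; trivial.
Qed.

Lemma near_refl d x : 0 <= d -> near d x x.
Proof. intros; apply near_same; trivial. exists 0%Z. ring. Qed.

Lemma near_walk d x y a : near (a - Rabs d) (x + d) y -> near a x y.
Proof.
  intros [k Hk]. exists k.
  replace (x - y - IZR k * 100) with ((x + d - y - IZR k * 100) + - d) by ring.
  pose proof (Rabs_triang (x + d - y - IZR k * 100) (- d)).
  rewrite Rabs_Ropp in H. lra.
Qed.

Lemma far_walk d x a : far a x -> far (a - Rabs d) (x + d).
Proof.
  intros H k. specialize (H k).
  pose proof (Rabs_triang (x + d - IZR k * 100) (- d)) as Ht.
  rewrite Rabs_Ropp in Ht.
  replace (x + d - IZR k * 100 + - d) with (x - IZR k * 100) in Ht by ring. lra.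
Qed.

Lemma far_not_base d x : 0 <= d -> far d x -> ~ same_point x base.
Proof.
  intros Hd Hf [k Hk]. specialize (Hf k). unfold base, circumference in Hk.
  replace (x - IZR k * 100) with 0 in Hf by lra. rewrite Rabs_R0 in Hf. lra.
Qed.

Lemma far_weaken d d' x : d' <= d -> far d x -> far d' x.
Proof. intros H Hf k; specialize (Hf k); lra. Qed.

(** The box in use does not last, so another one is opened when it is empty.  That
    box has been moved, if at all, only by the walker on this stretch. *)
Lemma box_within s legs f :
  run s legs f -> same_point (pos f) base -> 0 <= food s ->
  far (20 * food s) (pos s) ->
  has_one (near (20 * food s) (pos s)) (boxes s).
Proof.
  induction 1 as [s|s s' legs f Hh Hr IH|x r c l d legs f Hd Hr IH];
    intros Hb Hf Hfar.
  - exfalso; eapply far_not_base; [| |exact Hb]; [|exact Hfar]. lra.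
  - specialize (IH Hb).
    destruct Hh as [x r l l' Ht|x r l|x l|x c l l' Ht]; cbn [pos food] in *.
    + destruct Ht as [l Hx|l1 y l2 Hy].
      * exfalso; eapply far_not_base; [| |exact Hx]; [|exact Hfar]; lra.
      * exists y. split; [cbn; apply in_elt|apply near_same; trivial; lra].
    + exact (IH Hf Hfar).
    + exists x. split; [left; trivial|apply near_refl; lra].
    + destruct Ht as [l Hx|l1 y l2 Hy].
      * exfalso; eapply far_not_base; [| |exact Hx]; [|exact Hfar]; lra.
      * exists y. split; [|apply near_same; trivial; lra].
        unfold boxes; cbn. apply in_or_app; right. apply in_elt.
  - cbn [pos food] in *. unfold miles_per_day in *.
    pose proof (Rabs_pos d).
    replace (20 * (r - Rabs d / 20)) with (20 * r - Rabs d) in IH by field.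
    destruct IH as (y & Hin & Hn); [trivial|lra|apply far_walk; trivial|].
    unfold boxes in *; cbn in *. destruct c.
    + destruct Hin as [<-|Hin].
      * exists x. split; [left; trivial|apply near_refl; lra].
      * exists y. split; [right; trivial|eapply near_walk; eauto].
    + exists y. split; [trivial|eapply near_walk; eauto].
Qed.

(** One box to replace the box in use, and a second one to replace the first. *)
Lemma two_boxes_within s legs f :
  run s legs f -> same_point (pos f) base -> 0 <= food s ->
  far (20 * food s + 20) (pos s) ->
  has_two (near (20 * food s) (pos s)) (near (20 * food s + 20) (pos s)) (boxes s).
Proof.
  induction 1 as [s|s s' legs f Hh Hr IH|x r c l d legs f Hd Hr IH];
    intros Hb Hf Hfar.
  - exfalso; eapply far_not_base; [| |exact Hb]; [|exact Hfar]. lra.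
  - specialize (IH Hb).
    pose proof (box_within s' legs f Hr Hb) as Hone.
    destruct Hh as [x r l l' Ht|x r l|x l|x c l l' Ht]; cbn [pos food] in *.
    + destruct Ht as [l Hx|l1 y l2 Hy].
      * exfalso; eapply far_not_base; [| |exact Hx]; [|exact Hfar]; lra.
      * specialize (IH Hf Hfar). unfold boxes in *; cbn in *.
        assert (Hy' : has_two (near (20 * r) x) (near (20 * r + 20) x) (y :: l1 ++ l2)).
        { eapply has_two_change; [..|exact IH]; trivial;
            intros _; apply near_same; trivial; lra. }
        destruct Hy' as (y1 & y2 & l' & HP & HQ). exists y1, y2, l'.
        split; [|exact HQ]. rewrite <- HP. symmetry. apply Permutation_middle.
    + exact (IH Hf Hfar).
    + destruct Hone as (z & Hz & Hn); [lra| |].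
      { eapply far_weaken; [|exact Hfar]; lra. }
      unfold boxes in *; cbn in *.
      apply in_split in Hz. destruct Hz as (a & b & ->).
      exists x, z, (a ++ b). split; [|split].
      * apply perm_skip. symmetry. apply Permutation_middle.
      * apply near_refl; lra.
      * replace (20 * 0 + 20) with (20 * 1) by ring. trivial.
    + destruct Ht as [l Hx|l1 y l2 Hy].
      * exfalso; eapply far_not_base; [| |exact Hx]; [|exact Hfar]; lra.
      * destruct Hone as (z & Hz & Hn); [lra| |].
        { eapply far_weaken; [|exact Hfar]; lra. }
        apply in_split in Hz. destruct Hz as (a & b & Hab).
        exists y, z, (a ++ b). split; [|split].
        -- assert (HP : Permutation (boxes (State x 0 c (l1 ++ y :: l2)))
                           (y :: boxes (State x 1 c (l1 ++ l2)))).
           { unfold boxes; cbn. rewrite !app_assoc. symmetry. apply Permutation_middle. }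
           rewrite HP, Hab. apply perm_skip. symmetry. apply Permutation_middle.
        -- apply near_same; trivial; lra.
        -- replace (20 * 0 + 20) with (20 * 1) by ring. trivial.
  - cbn [pos food] in *. unfold miles_per_day in *.
    pose proof (Rabs_pos d).
    replace (20 * (r - Rabs d / 20)) with (20 * r - Rabs d) in IH by field.
    replace (20 * r - Rabs d + 20) with (20 * r + 20 - Rabs d) in IH by ring.
    specialize (IH Hb ltac:(lra) (far_walk _ _ _ Hfar)).
    unfold boxes in *; cbn in *. destruct c; cbn in *.
    + eapply has_two_change; [..|exact IH].
      * intros z; apply near_walk.
      * intros z; apply near_walk.
      * intros _; apply near_refl; lra.
      * intros _; apply near_refl; lra.
    + eapply has_two_weaken; [..|exact IH]; intros z; apply near_walk.
Qed.

Lemma miles_cons x d legs :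
  miles_walked ((x, x + d) :: legs) = Rabs d + miles_walked legs.
Proof. unfold miles_walked; cbn. do 2 f_equal. ring. Qed.

Lemma miles_nonneg legs : 0 <= miles_walked legs.
Proof.
  unfold miles_walked. induction legs as [|leg legs IH]; cbn; [lra|].
  pose proof (Rabs_pos (snd leg - fst leg)). lra.
Qed.

Lemma miles_to_base s legs f a :
  run s legs f -> same_point (pos f) base ->
  (forall k : Z, a <= Rabs (pos s - IZR k * 100)) -> a <= miles_walked legs.
Proof.
  intros Hr. revert a. induction Hr as [s|s s' legs f Hh Hr IH|x r c l d legs f Hd Hr IH];
    intros a Hb Ha.
  - destruct Hb as [k Hk]. specialize (Ha k). unfold base, circumference in Hk.
    replace (pos s - IZR k * 100) with 0 in Ha by lra. rewrite Rabs_R0 in Ha.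
    cbn. lra.
  - apply IH; trivial. destruct Hh; exact Ha.
  - rewrite miles_cons. cbn [pos] in *.
    assert (a - Rabs d <= miles_walked legs); [|lra].
    apply IH; trivial. intros k. specialize (Ha k).
    pose proof (Rabs_triang (x + d - IZR k * 100) (- d)) as Ht.
    rewrite Rabs_Ropp in Ht.
    replace (x + d - IZR k * 100 + - d) with (x - IZR k * 100) in Ht by ring. lra.
Qed.

(** * The moment when the visited points close up *)

Definition inside (lo hi : R) (l : list R) : Prop := Forall (fun y => lo <= y <= hi) l.

Lemma inside_mono lo hi lo' hi' l :
  lo' <= lo -> hi <= hi' -> inside lo hi l -> inside lo' hi' l.
Proof. intros H1 H2. apply Forall_impl. intros; lra. Qed.

Lemma same_point_eq x y : Rabs (x - y) < 100 -> same_point x y -> x = y.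
Proof.
  intros Hd [k Hk]. unfold circumference in Hk.
  assert (k = 0%Z) by (apply one_IZR_lt1; revert Hd; rewrite Hk; rabs).
  subst k. lra.
Qed.

Lemma handle_line lo hi P s s' :
  hi - lo < 100 -> lo <= 0 <= hi -> lo <= pos s <= hi -> - P <= pos s ->
  inside lo hi (caches s) -> handle s s' ->
  line_handle P s s' /\ pos s' = pos s /\ inside lo hi (caches s') /\
  (0 <= food s <= 1 -> 0 <= food s' <= 1).
Proof.
  intros Hlh H0 Hx HP Hl Hh.
  assert (Htake : forall l l', inside lo hi l -> take_box (pos s) l l' ->
            line_take (pos s) l l' /\ inside lo hi l').
  { intros l l' Hin Ht; revert Hin; destruct Ht as [l0 Hb|l1 y l2 Hy]; intros Hin.
    - split; [left; split; [|reflexivity]|exact Hin].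
      apply same_point_eq; [unfold base; rabs|exact Hb].
    - unfold inside in *. apply Forall_app in Hin. destruct Hin as [Hin1 Hin2].
      inversion Hin2 as [|? ? Hyin Hin3]; subst.
      apply same_point_eq in Hy; [|rabs]. subst y. split.
      + right. symmetry. apply Permutation_middle.
      + apply Forall_app; auto. }
  destruct Hh as [x r l l' Ht|x r l|x l|x c l l' Ht]; cbn [pos food caches] in *.
  - destruct (Htake _ _ Hl Ht). split; [apply line_pick_up; trivial|].
    split; [trivial|split; [trivial|lra]].
  - split; [apply line_drop|]. split; [trivial|split; [constructor; trivial|lra]].
  - split; [apply line_open_carried; lra|].
    split; [trivial|split; [trivial|lra]].
  - destruct (Htake _ _ Hl Ht). split; [apply line_open_lying; trivial; lra|].
    split; [trivial|split; [trivial|lra]].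
Qed.

Lemma uncovered lo hi :
  lo <= hi -> hi - lo < 100 ->
  exists p, ~ exists q, lo <= q <= hi /\ same_point q p.
Proof.
  intros H1 H2. exists ((hi + lo + 100) / 2). intros (q & Hq & Hs).
  apply same_point_eq in Hs; [lra|]. rabs.
Qed.

Lemma walk_run x r c l d d1 legs f :
  Rabs d <= 20 * r -> Rabs d = Rabs d1 + Rabs (d - d1) ->
  run (State (x + d) (r - Rabs d / 20) c l) legs f ->
  run (walked (State x r c l) d1) ((x + d1, x + d) :: legs) f.
Proof.
  intros Hd Hs Hr. unfold walked; cbn.
  pose proof (Rabs_pos d1). pose proof (Rabs_pos (d - d1)).
  replace (x + d) with (x + d1 + (d - d1)) by ring.
  apply run_walk; unfold miles_per_day.
  - lra.
  - replace (x + d1 + (d - d1)) with (x + d) by ring.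
    replace (r - Rabs d1 / 20 - Rabs (d - d1) / 20) with (r - Rabs d / 20) by lra.
    exact Hr.
Qed.

(** [[lo, hi]] is the set of points visited so far.  The run is followed until
    it has length 100, and cut at two moments: [s1], where it gets this length,
    the walker being at one of its ends, and [sm], where the other end had been
    reached.  Unless that end is a point of the initial interval, the walker was
    there at [sm].  An interval of length 100 around the base has no point
    farther west than 100; hence the depth 100. *)
Lemma closing_split s legs f :
  run s legs f -> forall lo hi,
  same_point (pos f) base -> lo <= 0 <= hi -> hi - lo < 100 ->
  lo <= pos s <= hi -> inside lo hi (caches s) ->
  (forall p, (exists q, lo <= q <= hi /\ same_point q p) \/ visits legs p) ->
  exists lo' hi' sm s1 Ma Mb legs2,
    lo' <= lo /\ hi <= hi' /\ hi' = lo' + 100 /\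
    line_run lo' hi' 100 s Ma sm /\ line_run lo' hi' 100 sm Mb s1 /\
    run s1 legs2 f /\ miles_walked legs = Ma + Mb + miles_walked legs2 /\
    inside lo' hi' (caches s1) /\
    ((pos s1 = hi' /\ (lo' = lo \/ pos sm = lo')) \/
     (pos s1 = lo' /\ (hi' = hi \/ pos sm = hi'))).
Proof.
  induction 1 as [s|s s' legs f Hh Hr IH|x r c l d legs f Hd Hr IH];
    intros lo hi Hb H0 Hlh Hx Hl Hcov.
  - exfalso. destruct (uncovered lo hi) as [p Hp]; [lra|lra|].
    destruct (Hcov p) as [H|(a & b & q & [] & _)]. contradiction.
  - destruct (handle_line lo hi 100 s s') as (Hlh' & Hp & Hl' & _); trivial; [lra|].
    destruct (IH lo hi) as (lo' & hi' & sm & s1 & Ma & Mb & legs2 & I1 & I2 & I3 & R1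
      & R2 & R3 & HM & Hin & Hend); trivial; [rewrite Hp; trivial|].
    exists lo', hi', sm, s1, Ma, Mb, legs2. do 3 (split; [assumption|]).
    split; [|repeat (split; [assumption|]); assumption].
    eapply line_step_handle; [|exact Hlh'|exact R1]. lra.
  - cbn [pos food caches] in *. change miles_per_day with 20 in *.
    pose proof (Rabs_pos d) as Hdp.
    rewrite miles_cons.
    destruct (Rle_dec (lo + 100) (x + d)) as [Hup|Hup];
      [|destruct (Rle_dec (x + d) (hi - 100)) as [Hdn|Hdn]].
    + set (d1 := lo + 100 - x).
      assert (Hsp : Rabs d = Rabs d1 + Rabs (d - d1)) by (unfold d1; rabs).
      pose proof (Rabs_pos d1). pose proof (Rabs_pos (d - d1)).
      exists lo, (lo + 100), (State x r c l), (walked (State x r c l) d1),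
        0, (Rabs d1 + 0), ((x + d1, x + d) :: legs).
      assert (pos (walked (State x r c l) d1) = lo + 100) by (unfold d1; cbn; ring).
      split; [lra|]. split; [lra|]. split; [trivial|].
      split; [constructor; cbn; lra|].
      split; [apply line_step_walk; [cbn; lra|cbn; lra|constructor; lra]|].
      split; [apply walk_run; trivial|].
      split; [replace (x + d) with (x + d1 + (d - d1)) by ring; rewrite miles_cons; lra|].
      split; [eapply inside_mono; [..|exact Hl]; lra|].
      left; split; [trivial|left; trivial].
    + set (d1 := hi - 100 - x).
      assert (Hsp : Rabs d = Rabs d1 + Rabs (d - d1)) by (unfold d1; rabs).
      pose proof (Rabs_pos d1). pose proof (Rabs_pos (d - d1)).
      exists (hi - 100), hi, (State x r c l), (walked (State x r c l) d1),
        0, (Rabs d1 + 0), ((x + d1, x + d) :: legs).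
      assert (pos (walked (State x r c l) d1) = hi - 100) by (unfold d1; cbn; ring).
      split; [lra|]. split; [lra|]. split; [lra|].
      split; [constructor; cbn; lra|].
      split; [apply line_step_walk; [cbn; lra|cbn; lra|constructor; lra]|].
      split; [apply walk_run; trivial|].
      split; [replace (x + d) with (x + d1 + (d - d1)) by ring; rewrite miles_cons; lra|].
      split; [eapply inside_mono; [..|exact Hl]; lra|].
      right; split; [trivial|left; trivial].
    + set (lo2 := Rmin lo (x + d)). set (hi2 := Rmax hi (x + d)).
      assert (Hlo2 : lo2 <= lo /\ lo2 <= x + d /\ (lo2 = lo \/ lo2 = x + d)).
      { unfold lo2, Rmin; destruct Rle_dec; repeat split; auto; lra. }
      assert (Hhi2 : hi <= hi2 /\ x + d <= hi2 /\ (hi2 = hi \/ hi2 = x + d)).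
      { unfold hi2, Rmax; destruct Rle_dec; repeat split; auto; lra. }
      destruct Hlo2 as (HL1 & HL2 & HL3). destruct Hhi2 as (HH1 & HH2 & HH3).
      destruct (IH lo2 hi2) as (lo' & hi' & sm & s1 & Ma & Mb & legs2 & I1 & I2 & I3 & R1
        & R2 & R3 & HM & Hin & Hend); trivial; try lra.
      { eapply inside_mono; [..|exact Hl]; trivial. }
      { intros p. destruct (Hcov p) as [(q & Hq & Hs)|(a & b & q & [Heq|Hin] & Hq & Hs)].
        - left; exists q; split; [lra|trivial].
        - inversion Heq; subst a b. left; exists q; split; [|trivial].
          revert Hq. unfold Rmin, Rmax; repeat destruct Rle_dec; lra.
        - right; exists a, b, q; auto. }
      assert (R1' : line_run lo' hi' 100 (State x r c l) (Rabs d + Ma) sm).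
      { apply line_step_walk; [cbn; lra|cbn; lra|exact R1]. }
      assert (Rstep : line_run lo' hi' 100 (State x r c l) (Rabs d + 0)
                        (walked (State x r c l) d)).
      { apply line_step_walk; [cbn; lra|cbn; lra|constructor; cbn; lra]. }
      assert (R12 : line_run lo' hi' 100 (walked (State x r c l) d) (Ma + Mb) s1)
        by (eapply line_run_app; eauto).
      assert (Hmid : exists sm' Ma' Mb',
        line_run lo' hi' 100 (State x r c l) Ma' sm' /\
        line_run lo' hi' 100 sm' Mb' s1 /\ Ma' + Mb' = Rabs d + Ma + Mb /\
        ((pos s1 = hi' /\ (lo' = lo \/ pos sm' = lo')) \/
         (pos s1 = lo' /\ (hi' = hi \/ pos sm' = hi')))).
      { destruct Hend as [[He [Hm|Hm]]|[He [Hm|Hm]]].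
        - destruct HL3 as [HL3|HL3].
          + exists sm, (Rabs d + Ma), Mb. repeat split; trivial. left; split; [trivial|left; lra].
          + exists (walked (State x r c l) d), (Rabs d + 0), (Ma + Mb).
            repeat split; trivial; [lra|]. left; split; [trivial|right; cbn; lra].
        - exists sm, (Rabs d + Ma), Mb. repeat split; trivial. left; auto.
        - destruct HH3 as [HH3|HH3].
          + exists sm, (Rabs d + Ma), Mb. repeat split; trivial. right; split; [trivial|left; lra].
          + exists (walked (State x r c l) d), (Rabs d + 0), (Ma + Mb).
            repeat split; trivial; [lra|]. right; split; [trivial|right; cbn; lra].
        - exists sm, (Rabs d + Ma), Mb. repeat split; trivial. right; auto. }
      destruct Hmid as (sm' & Ma' & Mb' & Q1 & Q2 & Q3 & Q4).
      exists lo', hi', sm', s1, Ma', Mb', legs2.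
      split; [lra|]. split; [lra|]. do 4 (split; [assumption|]).
      split; [lra|]. split; assumption.
Qed.

(** The reflection that exchanges east and west. *)
Definition mirror (s : state) : state :=
  State (- pos s) (food s) (sealed s) (map Ropp (caches s)).

Definition mirror_leg (leg : R * R) : R * R := (- fst leg, - snd leg).

Lemma mirror_same_point x y : same_point x y -> same_point (- x) (- y).
Proof. intros [k Hk]. exists (- k)%Z. rewrite opp_IZR. lra. Qed.

Lemma mirror_take x l l' : take_box x l l' -> take_box (- x) (map Ropp l) (map Ropp l').
Proof.
  destruct 1 as [l H|l1 y l2 H].
  - apply take_base. replace base with (- base) by (unfold base; ring).
    apply mirror_same_point, H.
  - rewrite !map_app; cbn. apply take_cache, mirror_same_point, H.
Qed.

Lemma mirror_handle s s' : handle s s' -> handle (mirror s) (mirror s').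
Proof.
  destruct 1; unfold mirror; cbn; constructor; auto using mirror_take.
Qed.

Lemma mirror_run s legs f :
  run s legs f -> run (mirror s) (map mirror_leg legs) (mirror f).
Proof.
  induction 1 as [s|s s' legs f Hh Hr IH|x r c l d legs f Hd Hr IH]; cbn.
  - constructor.
  - eapply run_handle; [apply mirror_handle; eauto|trivial].
  - unfold mirror_leg at 1; cbn. unfold mirror at 1; cbn.
    replace (- (x + d)) with (- x + - d) by ring.
    apply run_walk; rewrite Rabs_Ropp; trivial.
    replace (- x + - d) with (- (x + d)) by ring. exact IH.
Qed.

Lemma mirror_miles legs : miles_walked (map mirror_leg legs) = miles_walked legs.
Proof.
  unfold miles_walked. induction legs as [|[a b] legs IH]; cbn; [reflexivity|].
  rewrite IH. f_equal. rewrite <- Rabs_Ropp. f_equal. ring.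
Qed.

Lemma mirror_line_handle P P' s s' :
  pos s <= P' -> line_handle P s s' -> line_handle P' (mirror s) (mirror s').
Proof.
  assert (Ht : forall x l l', line_take x l l' ->
                 line_take (- x) (map Ropp l) (map Ropp l')).
  { intros x l l' [[-> ->]|H].
    - left; split; [ring|reflexivity].
    - right. change (- x :: map Ropp l') with (map Ropp (x :: l')).
      apply Permutation_map, H. }
  intros HP; destruct 1; unfold mirror; cbn in *; constructor; auto; lra.
Qed.

Lemma mirror_line_run lo hi P s M s' :
  line_run lo hi P s M s' -> line_run (- hi) (- lo) hi (mirror s) M (mirror s').
Proof.
  induction 1 as [s Hs|s s' M s'' Hs Hh Hr IH|s d M s'' Hs Hd Hr IH].
  - constructor; cbn; lra.
  - eapply line_step_handle; [cbn; lra| |exact IH].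
    eapply mirror_line_handle; [|exact Hh]; lra.
  - rewrite <- (Rabs_Ropp d). apply line_step_walk; [cbn; lra|cbn; rewrite Rabs_Ropp; trivial|].
    replace (walked (mirror s) (- d)) with (mirror (walked s d)); trivial.
    unfold mirror, walked; cbn. rewrite Rabs_Ropp. f_equal. ring.
Qed.

Lemma mirror_inside lo hi l : inside lo hi l -> inside (- hi) (- lo) (map Ropp l).
Proof. unfold inside. induction 1; cbn; constructor; trivial; lra. Qed.

(** * Going home through the west *)

Lemma east_value_ge x : 32/3 * x - 180 <= value east x.
Proof. unfold_side. bound_hinges x. lra. Qed.

Lemma east_value_ge_mid x : 4 * x - 20 <= value east x.
Proof. unfold_side. bound_hinges x. lra. Qed.

Lemma west_value_ge_near P x : 10 <= P -> 2 * x <= value (west_home P) x.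
Proof. intros HP. unfold_side. bound_hinges x. lra. Qed.

Lemma west_value_ge_mid P x : 10 <= P -> 4 * x - 20 <= value (west_home P) x.
Proof. intros HP. unfold_side. bound_hinges x. lra. Qed.

Lemma west_value_ge_far P x : 10 <= P -> 12 * x - 4 * P - 140 <= value (west_home P) x.
Proof. intros HP. unfold_side. bound_hinges x. lra. Qed.

Lemma east_worth_ge p : 16/3 * p - 420 <= worth east p.
Proof. cbn. apply Rmax_r. Qed.

Lemma total_in v l a : (forall y, 0 <= v y) -> In a l -> v a <= total v l.
Proof.
  intros Hv Ha. apply in_split in Ha. destruct Ha as (l1 & l2 & ->).
  rewrite total_app. pose proof (total_nonneg v l1 Hv).
  pose proof (total_nonneg v l2 Hv). cbn. fold (total v l2). lra.
Qed.

Lemma total_two v l a b :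
  (forall y, 0 <= v y) -> In a l -> In b l -> a <> b -> v a + v b <= total v l.
Proof.
  intros Hv Ha Hb Hab. apply in_split in Ha. destruct Ha as (l1 & l2 & ->).
  rewrite (total_perm v (l1 ++ a :: l2) (a :: l1 ++ l2))
    by (symmetry; apply Permutation_middle).
  assert (Hb' : In b (l1 ++ l2)).
  { apply in_app_or in Hb. apply in_or_app. destruct Hb as [?|[->|?]]; auto. contradiction. }
  pose proof (total_in v _ b Hv Hb'). cbn. fold (total v (l1 ++ l2)). lra.
Qed.

Lemma total_perm_two v l y1 y2 l' :
  (forall y, 0 <= v y) -> Permutation l (y1 :: y2 :: l') -> v y1 + v y2 <= total v l.
Proof.
  intros Hv HP. rewrite (total_perm v _ _ HP). pose proof (total_nonneg v l' Hv).
  cbn. fold (total v l'). lra.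
Qed.

Lemma circle_distance x a :
  0 <= x <= 100 -> a <= x -> a <= 100 - x ->
  forall k : Z, a <= Rabs (x - IZR k * 100).
Proof.
  intros Hx H1 H2 k.
  destruct (Z_le_dec k 0) as [Hk|Hk].
  - apply IZR_le in Hk. rabs.
  - assert (1 <= k)%Z by lia. apply IZR_le in H. rabs.
Qed.

Lemma near_west u y d :
  0 <= u <= 50 -> -50 <= y < 0 -> d <= 40 -> near d (100 - u) y -> u - d <= - y.
Proof.
  intros Hu Hy Hd [k Hk].
  destruct (Z.eq_dec k 1) as [->|Hne]; [rabs|].
  destruct (Z_le_dec k 0) as [Hk0|Hk0].
  - apply IZR_le in Hk0. rabs.
  - assert (Hk2 : (2 <= k)%Z) by lia. apply IZR_le in Hk2. rabs.
Qed.

Lemma near_east u y d :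
  0 <= u <= 50 -> 0 <= y <= 100 -> d <= 40 -> d < u -> near d (100 - u) y ->
  100 - u - d <= y.
Proof.
  intros Hu Hy Hd Hdu [k Hk].
  destruct (Z.eq_dec k 0) as [->|Hne]; [rabs|].
  destruct (Z_le_dec k 0) as [Hk0|Hk0].
  - assert (Hk2 : (k <= -1)%Z) by lia. apply IZR_le in Hk2. rabs.
  - assert (Hk2 : (1 <= k)%Z) by lia. apply IZR_le in Hk2. rabs.
Qed.

Lemma near_closing b y d :
  0 <= b <= 50 -> - b <= y <= 100 - b -> d < b -> near d (- b) y -> b - d <= Rabs y.
Proof.
  intros Hb Hy Hdb [k Hk].
  destruct (Z.eq_dec k 0) as [->|Hne]; [rabs|].
  destruct (Z.eq_dec k (-1)) as [->|Hne']; [rabs|].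
  destruct (Z_le_dec k 0) as [Hk0|Hk0].
  - assert (Hk2 : (k <= -2)%Z) by lia. apply IZR_le in Hk2. rabs.
  - assert (Hk2 : (1 <= k)%Z) by lia. apply IZR_le in Hk2. rabs.
Qed.

Section LastStage.
Variable P : R.
Hypothesis HP : 10 <= P.

Let hE := east_fair.
Let hW := west_home_fair P HP.

(** The walker is u miles from the base, next to a box that came from the west,
    and all western boxes are still where their prices put them.  By reach alone
    there is a box he can get to with the box in use (g miles), and if this does
    not bring him within 20 miles of the base, a second one.  If one of them is
    an eastern box, its price comes on top of the eastern cost ([Heast]).
    If both are western, their prices are at least those at the distances
    u - g and u - g - 20, and the floors of [east] and [mild] give the bound
    below and above 115/4. *)
Lemma touch_west s legs f u M :
  run s legs f -> same_point (pos f) base ->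
  pos s = 100 - u -> 0 < u <= 50 -> In (- u) (caches s) ->
  Forall (fun y => - 50 <= y <= 100) (boxes s) ->
  secured east (west_home P) east_floor s M ->
  secured mild (west_home P) mild_floor s M ->
  1805/4 <= M + (4 * P - 40) + miles_walked legs.
Proof.
  intros Hr Hb Hx Hu Hin Hbox HsE HsM.
  destruct HsE as (Hf & HE & _). destruct HsM as (_ & HM' & _).
  destruct (HE ltac:(lra)) as [Hcov HflE]. destruct (HM' ltac:(lra)) as [_ HflM].
  clear HE HM'. assert (Hg : 0 <= 20 * food s <= 20) by lra.
  set (g := 20 * food s) in Hcov, HflE, HflM, Hg.
  unfold east_floor, mild_floor in *. rewrite Hx in *.
  assert (Hfar : forall k : Z, u <= Rabs (pos s - IZR k * 100)).
  { rewrite Hx. apply circle_distance; lra. }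
  pose proof (miles_to_base s legs f u Hr Hb Hfar) as HD.
  assert (Hnn : forall y, 0 <= left_price (west_home P) y)
    by (intros; eapply left_price_nonneg; eauto).
  assert (HnnE : forall y, 0 <= price east (west_home P) y)
    by (intros; eapply price_nonneg; eauto).
  pose proof (total_nonneg _ (boxes s) Hnn) as HS0.
  assert (Hub : In (- u) (boxes s)) by (unfold boxes; apply in_or_app; auto).
  rewrite Forall_forall in Hbox.
  assert (Heast : forall y d, In y (boxes s) -> 0 <= y -> 100 - u - d <= y -> d <= g + 20 ->
            1805/4 <= M + (4 * P - 40) + miles_walked legs).
  { intros y d Hy Hy0 Hyd Hd.
    assert (Hq : Rabs (100 - u + g - (100 - u)) <= g) by rabs.
    specialize (Hcov (100 - u + g) ltac:(cbn; lra) Hq).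
    replace ((100 - u + (100 - u + g) + g) / 2) with (100 - u + g) in Hcov by field.
    rewrite !east_value_far in Hcov by lra.
    pose proof (east_worth_ge (100 - u + g)).
    pose proof (total_two _ _ y (- u) HnnE Hy Hub ltac:(lra)) as Ht.
    rewrite (price_right east _ y) in Ht by trivial.
    rewrite (price_left east (west_home P)) in Ht by (trivial; lra).
    rewrite Ropp_involutive in Ht.
    pose proof (east_value_ge y). pose proof (west_value_ge_far P u HP). lra. }
  destruct (Rle_dec u g) as [Hug|Hug]; [lra|].
  assert (Hwest : forall y, y < 0 -> left_price (west_home P) y = value (west_home P) (- y)).
  { intros y Hy. unfold left_price. destruct Rle_dec; [lra|trivial]. }
  destruct (Rle_dec (u - g) 20) as [Hw|Hw].
  - destruct (box_within s legs f Hr Hb) as (y & Hy & Hny); [lra| |].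
    { intros k. specialize (Hfar k). fold g. lra. }
    fold g in Hny. rewrite Hx in Hny.
    specialize (Hbox y Hy). cbn in Hbox.
    destruct (Rle_dec 0 y) as [Hy0|Hy0].
    + apply (Heast y g); trivial; [|lra]. apply near_east; trivial; lra.
    + pose proof (near_west u y g ltac:(lra) ltac:(lra) ltac:(lra) Hny).
      pose proof (total_in _ _ y Hnn Hy) as Ht. rewrite Hwest in Ht by lra.
      pose proof (west_value_ge_mid P (- y) HP). lra.
  - destruct (two_boxes_within s legs f Hr Hb) as (y1 & y2 & l' & HPm & Hn1 & Hn2); [lra| |].
    { intros k. specialize (Hfar k). fold g. lra. }
    fold g in Hn1, Hn2. rewrite Hx in Hn1, Hn2.
    assert (Hy1 : In y1 (boxes s))
      by (eapply Permutation_in; [symmetry; exact HPm|left; trivial]).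
    assert (Hy2 : In y2 (boxes s))
      by (eapply Permutation_in; [symmetry; exact HPm|right; left; trivial]).
    pose proof (Hbox y1 Hy1) as Hb1. pose proof (Hbox y2 Hy2) as Hb2. cbn in Hb1, Hb2.
    destruct (Rle_dec 0 y1) as [Hp1|Hp1]; [|destruct (Rle_dec 0 y2) as [Hp2|Hp2]].
    + apply (Heast y1 g); trivial; [|lra]. apply near_east; trivial; lra.
    + apply (Heast y2 (g + 20)); trivial; [|lra]. apply near_east; trivial; lra.
    + pose proof (near_west u y1 g ltac:(lra) ltac:(lra) ltac:(lra) Hn1).
      pose proof (near_west u y2 (g + 20) ltac:(lra) ltac:(lra) ltac:(lra) Hn2).
      pose proof (total_perm_two _ _ _ _ _ Hnn HPm) as Ht.
      rewrite !Hwest in Ht by lra.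
      pose proof (west_value_ge_far P (- y1) HP).
      pose proof (west_value_ge_near P (- y2) HP).
      destruct (Rle_dec (u - g) (115/4)); lra.
Qed.

(** Until a western box is touched, the western total does not change and the
    eastern prices stay valid on the whole arc of 100 miles.  Reaching the base
    through the west without touching a western box costs 700 miles by the
    floor; returning through the east costs the set-aside W. *)
Lemma last_stage s legs f W M :
  run s legs f -> same_point (pos f) base ->
  0 < pos s < 100 -> Forall (fun y => - 50 <= y <= 100) (boxes s) ->
  1805/4 <= W + (4 * P - 40) ->
  secured east (west_home P) east_floor s M ->
  secured mild (west_home P) mild_floor s M ->
  secured east_home (west_home P) no_floor s (M - W) ->
  1805/4 <= M + (4 * P - 40) + miles_walked legs.
Proof.
  intros Hr. revert M.
  induction Hr as [s|s s' legs f Hh Hr IH|x r c l d legs f Hd Hr IH];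
    intros M Hb Hx Hbox HW HE HM HH.
  - exfalso. assert (100 < 0) as H100; [|lra].
    assert (pos s = 0); [|lra]. apply same_point_eq; [rabs|exact Hb].
  - assert (Hcase : (line_handle P s s' /\ pos s' = pos s /\
               Forall (fun y => - 50 <= y <= 100) (boxes s')) \/
             exists u, pos s = 100 - u /\ 0 < u <= 50 /\ In (- u) (caches s)).
    { assert (Htake : forall c l l', take_box (pos s) l l' ->
         Forall (fun y => - 50 <= y <= 100) (boxes (State (pos s) (food s) c l)) ->
         (line_take (pos s) l l' /\ Forall (fun y => - 50 <= y <= 100) l') \/
         exists u, pos s = 100 - u /\ 0 < u <= 50 /\ In (- u) l).
      { intros c l l' Ht Hl. assert (Hl' : Forall (fun y => - 50 <= y <= 100) l).
        { unfold boxes in Hl; cbn in Hl. apply Forall_app in Hl. apply Hl. }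
        clear Hl. revert Hl'. destruct Ht as [l Hbx|l1 y l2 Hy]; intros Hl.
        - exfalso. assert (pos s = 0); [|lra]. apply same_point_eq; [rabs|exact Hbx].
        - apply Forall_app in Hl. destruct Hl as [Hl1 Hl2].
          inversion Hl2 as [|? ? Hyb Hl3]; subst.
          destruct (Rlt_dec (Rabs (pos s - y)) 100) as [Hlt|Hge].
          + left. apply same_point_eq in Hy; trivial. subst y. split.
            * right. symmetry. apply Permutation_middle.
            * apply Forall_app; auto.
          + right. exists (- y). destruct Hy as [k Hk]. unfold circumference in Hk.
            assert (k = 1%Z).
            { cut ((k - 1)%Z = 0%Z); [lia|]. apply one_IZR_lt1. rewrite minus_IZR.
              revert Hge. rabs. }
            subst k. rewrite Ropp_involutive. repeat split; try lra.
            apply in_elt. }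
      destruct Hh as [x r l l' Ht|x r l|x l|x c l l' Ht]; cbn [pos food caches] in *.
      - destruct (Htake false l l' Ht Hbox) as [[H1 H2]|H]; [left|right; trivial].
        split; [apply line_pick_up; trivial|split; [trivial|]].
        unfold boxes; cbn. constructor; trivial; lra.
      - left. split; [apply line_drop|split; [trivial|exact Hbox]].
      - left. split; [apply line_open_carried; lra|split; [trivial|]].
        unfold boxes in *; cbn in *. inversion Hbox; trivial.
      - destruct (Htake c l l' Ht Hbox) as [[H1 H2]|H]; [left|right; trivial].
        split; [apply line_open_lying; trivial; lra|split; [trivial|]].
        unfold boxes in *; cbn in *. apply Forall_app in Hbox. apply Forall_app.
        split; [apply Hbox|trivial]. }
    destruct Hcase as [(Hl & Hp & Hbox')|(u & Hu1 & Hu2 & Hu3)].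
    + apply IH; trivial; [lra|..];
        (eapply secured_handle; [..|exact Hl|eassumption];
         auto using east_fair, mild_fair, east_home_fair, west_home_fair,
           east_floor_ok, mild_floor_ok, east_home_floor_ok; cbn; lra).
    + apply (touch_west s legs f u M); trivial. eapply run_handle; eauto.
  - cbn [pos food] in *. change miles_per_day with 20 in *.
    rewrite miles_cons. pose proof (miles_nonneg legs).
    set (s := State x r c l) in *.
    destruct (Rle_dec 100 (x + d)) as [Hup|Hup]; [|destruct (Rle_dec (x + d) 0) as [Hdn|Hdn]].
    + assert (Hd1 : Rabs (100 - x) <= Rabs d) by rabs.
      pose proof (secured_walk east (west_home P) east_floor east_fair hW
        east_floor_ok s (100 - x) M ltac:(cbn; lra) HE) as (Hf' & Hc & _).
      destruct Hc as [_ Hfl]; [cbn; lra|].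
      assert (Hnn : forall y, 0 <= left_price (west_home P) y)
        by (intros; apply (left_price_nonneg east (west_home P)); [apply east_fair|exact hW]).
      pose proof (total_nonneg _ (boxes (walked s (100 - x))) Hnn).
      assert (pos (walked s (100 - x)) = 100) as Hp by (cbn; ring).
      rewrite Hp in Hfl. unfold east_floor in Hfl. lra.
    + assert (Hd1 : Rabs (- x) <= Rabs d) by rabs.
      pose proof (secured_walk east_home (west_home P) no_floor east_home_fair hW
        east_home_floor_ok s (- x) (M - W) ltac:(cbn; lra) HH) as Hs.
      apply secured_at_base in Hs; [|apply east_home_fair|cbn; ring].
      assert (Hnn : forall y, 0 <= price east_home (west_home P) y)
        by (intros; apply price_nonneg; [apply east_home_fair|exact hW]).
      pose proof (total_nonneg _ (boxes (walked s (- x))) Hnn). lra.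
    + replace (M + (4 * P - 40) + (Rabs d + miles_walked legs))
        with (M + Rabs d + (4 * P - 40) + miles_walked legs) by ring.
      apply IH; trivial; [lra|..].
      * unfold boxes in *; cbn in *. destruct c; cbn in *; [|trivial].
        inversion Hbox; constructor; trivial; lra.
      * apply (secured_walk east (west_home P) east_floor east_fair hW
          east_floor_ok s d M); trivial.
      * apply (secured_walk mild (west_home P) mild_floor mild_fair hW
          mild_floor_ok s d M); trivial.
      * replace (M + Rabs d - W) with (M - W + Rabs d) by ring.
        apply (secured_walk east_home (west_home P) no_floor east_home_fair hW
          east_home_floor_ok s d (M - W)); trivial.
Qed.

End LastStage.

(** * Putting the two sides together *)

Lemma secured_start A B e s :
  fair A -> fair B -> floor_ok A e ->
  pos s = 0 -> 0 <= food s <= 1 -> boxes s = [] -> secured A B e s 0.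
Proof.
  intros HA HB He Hp Hf Hs. apply secured_base; trivial. rewrite Hs. cbn. lra.
Qed.

(** The switch from [west P] to [west_home P] at the deepest opening. *)
Lemma secured_opens A e lo hi P s M s' m :
  fair A -> floor_ok A e -> 10 <= P -> hi <= open_limit A ->
  opens_at P lo hi s M s' -> secured A (west P) e s m ->
  secured A (west_home P) e s' (m + M - (4 * P - 40)).
Proof.
  intros HA He HP Hhi (sP & M1 & M2 & R1 & Hp & Hf & R2 & ->) Hs.
  pose proof (secured_line_run A (west P) e lo hi P s M1 sP m HA (west_fair P HP) He
    ltac:(cbn; lra) Hhi R1 Hs) as H1.
  assert (H2 : secured A (west_home P) e sP (m + M1 - (4 * P - 40))).
  { apply (secured_switch_left A (west P) (west_home P) e sP _ _ eq_refl);
      [lra| |exact H1].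
    intros K. rewrite Hp, Hf, Ropp_involutive, Rmult_0_r. apply west_switch; trivial. }
  replace (m + (M1 + M2) - (4 * P - 40)) with (m + M1 - (4 * P - 40) + M2) by ring.
  apply (secured_line_run A (west_home P) e lo hi P sP M2 s'); auto using west_home_fair.
  cbn; lra.
Qed.

Lemma secured_after A e lo hi P s0 M sm M' s1 :
  fair A -> floor_ok A e -> 10 <= P -> hi <= open_limit A ->
  line_run lo hi P s0 M sm -> line_run lo hi P sm M' s1 ->
  P = 10 \/ opens_at P lo hi s0 M sm \/ opens_at P lo hi sm M' s1 ->
  pos s0 = 0 -> 0 <= food s0 <= 1 -> boxes s0 = [] ->
  secured A (west_home P) e s1 (M + M' - (4 * P - 40)).
Proof.
  intros HA He HP Hhi R1 R2 Hatt Hp Hf Hs.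
  pose proof (west_fair P HP) as HW. pose proof (west_home_fair P HP) as HW'.
  destruct Hatt as [->|[Ho|Ho]].
  - replace (M + M' - (4 * 10 - 40)) with (0 + M + M') by ring.
    apply (secured_line_run A (west_home 10) e lo hi 10 sm M' s1); trivial; try (cbn; lra).
    apply (secured_line_run A (west_home 10) e lo hi 10 s0 M sm); trivial; try (cbn; lra).
    apply secured_start; trivial.
  - replace (M + M' - (4 * P - 40)) with (0 + M - (4 * P - 40) + M') by ring.
    apply (secured_line_run A (west_home P) e lo hi P sm M' s1); trivial; try (cbn; lra).
    apply (secured_opens A e lo hi P s0); trivial. apply secured_start; trivial.
  - replace (M + M') with (0 + M + M') by ring.
    apply (secured_opens A e lo hi P sm); trivial.
    apply (secured_line_run A (west P) e lo hi P s0 M sm); trivial; try (cbn; lra).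
    apply secured_start; trivial.
Qed.

Lemma boxes_inside lo hi s :
  lo <= pos s <= hi -> inside lo hi (caches s) -> inside lo hi (boxes s).
Proof.
  intros Hp Hl. unfold boxes, inside in *. apply Forall_app. split; trivial.
  destruct (sealed s); constructor; trivial.
Qed.

(** The western end of the interval lies at most 10 miles beyond the deepest
    western opening, so the round trips to both ends suffice in case of a return
    through the east. *)
Lemma closing_east a b s0 sm s1 Ma Mb legs f :
  50 <= b -> 0 <= a -> a + b = 100 ->
  line_run (- a) b 100 s0 Ma sm -> line_run (- a) b 100 sm Mb s1 ->
  pos s1 = b -> a = 0 \/ pos sm = - a ->
  inside (- a) b (caches s1) ->
  run s1 legs f -> same_point (pos f) base ->
  pos s0 = 0 -> 0 <= food s0 <= 1 -> boxes s0 = [] ->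
  1805/4 <= Ma + Mb + miles_walked legs.
Proof.
  intros Hb Ha Hab R1 R2 Hp1 Hm Hin Hr Hbase Hp0 Hf0 Hs0.
  destruct (line_run_deepest2 _ _ _ _ _ _ _ _ R1 R2) as (P & HP & Q1 & Q2 & Hatt).
  pose proof (secured_after east east_floor (- a) b P _ _ _ _ _ east_fair east_floor_ok HP
    ltac:(cbn; lra) Q1 Q2 Hatt Hp0 Hf0 Hs0) as HE.
  pose proof (secured_after mild mild_floor (- a) b P _ _ _ _ _ mild_fair mild_floor_ok HP
    ltac:(cbn; lra) Q1 Q2 Hatt Hp0 Hf0 Hs0) as HM.
  set (M := Ma + Mb - (4 * P - 40)) in *.
  assert (HH : secured east_home (west_home P) no_floor s1 (M - (64/3 * b - 720))).
  { apply (secured_switch_right east east_home _ east_floor no_floor s1 M _ eq_refl);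
      [lra| | |exact HE].
    - intros K. rewrite Hp1. apply east_switch; [lra|]. destruct HE; lra.
    - destruct HE as [Hf _]. unfold no_floor, east_floor. lra. }
  assert (HaP : a <= P + 10).
  { destruct Hm as [->|Hm]; [lra|].
    assert (Hwl : within_left P sm).
    { eapply (within_left_run _ _ P s0 Ma sm); [lra|exact Q1|]. split; [trivial|lra]. }
    assert (Hrl : reached_left P a s1).
    { eapply (reached_left_run _ _ P a sm Mb s1); [lra|exact Q2|].
      destruct Hwl as [Hfm Hwl]. split; [trivial|].
      destruct (Rle_dec a 0); [left; lra|right]. rewrite Hm in *.
      specialize (Hwl ltac:(lra)). lra. }
    destruct Hrl as [_ [H|[H _]]]; lra. }
  replace (Ma + Mb + miles_walked legs) with (M + (4 * P - 40) + miles_walked legs)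
    by (unfold M; ring).
  destruct (Rlt_dec b 100) as [Hlt|Hge].
  - eapply (last_stage P HP s1 legs f (64/3 * b - 720)); trivial; try lra.
    assert (Hbi : inside (- a) b (boxes s1)) by (apply boxes_inside; trivial; lra).
    eapply Forall_impl; [|exact Hbi]. cbn. intros; lra.
  - destruct HE as (Hf & HE & _). destruct HE as [_ HE]; [lra|].
    assert (Hnn : forall y, 0 <= left_price (west_home P) y).
    { intros. apply (left_price_nonneg east (west_home P)); [apply east_fair|].
      apply west_home_fair, HP. }
    pose proof (total_nonneg _ (boxes s1) Hnn). pose proof (miles_nonneg legs).
    unfold east_floor in HE. lra.
Qed.

(** At the closing point, c miles west of the base, the two boxes that the way
    home requires may lie on either side; both prices are at least
    [4 * x - 20] at distance x. *)
Lemma closing_boxes B c b s1 legs f :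
  fair B -> (forall x, 4 * x - 20 <= value B x) ->
  0 <= c <= 50 -> c + b = 100 -> pos s1 = - c -> inside (- c) b (caches s1) ->
  run s1 legs f -> same_point (pos f) base -> 0 <= food s1 <= 1 ->
  20 * food s1 + 20 < c ->
  8 * c - 160 * food s1 - 120 <= total (price east_home B) (boxes s1).
Proof.
  intros HB Hmid Hc Hcb Hp1 Hin Hr Hbase Hf Hgc.
  assert (Hfar : far (20 * food s1 + 20) (pos s1)).
  { intros k. rewrite Hp1. apply Rlt_le_trans with c; [lra|].
    rewrite <- Rabs_Ropp.
    replace (- (- c - IZR k * 100)) with (c - IZR (- k) * 100) by (rewrite opp_IZR; ring).
    apply circle_distance; lra. }
  destruct (two_boxes_within s1 legs f Hr Hbase ltac:(lra) Hfar)
    as (y1 & y2 & l' & HPm & Hn1 & Hn2).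
  rewrite Hp1 in Hn1, Hn2.
  assert (Hbi : inside (- c) b (boxes s1)) by (apply boxes_inside; trivial; lra).
  unfold inside in Hbi. rewrite Forall_forall in Hbi.
  assert (Hy1 : In y1 (boxes s1))
    by (eapply Permutation_in; [symmetry; exact HPm|left; trivial]).
  assert (Hy2 : In y2 (boxes s1))
    by (eapply Permutation_in; [symmetry; exact HPm|right; left; trivial]).
  apply Hbi in Hy1, Hy2. cbn in Hy1, Hy2.
  pose proof (near_closing c y1 (20 * food s1) Hc ltac:(lra) ltac:(lra) Hn1) as Hd1.
  pose proof (near_closing c y2 (20 * food s1 + 20) Hc ltac:(lra) ltac:(lra) Hn2) as Hd2.
  assert (Hnn : forall y, 0 <= price east_home B y)
    by (intros; apply price_nonneg; trivial using east_home_fair).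
  pose proof (total_perm_two _ _ _ _ _ Hnn HPm) as Ht.
  assert (Hprice : forall y, 4 * Rabs y - 20 <= price east_home B y).
  { intros y. destruct (Rle_dec 0 y).
    - rewrite price_right, Rabs_pos_eq by trivial. apply east_value_ge_mid.
    - rewrite price_left, Rabs_left by (trivial using east_home_fair; lra). apply Hmid. }
  pose proof (Hprice y1). pose proof (Hprice y2). lra.
Qed.

(** The eastern round trip to b has been made, and is set aside as W.  Two boxes
    are needed unless the box in use and one more last to the base.  The plan
    used is to go straight home; if it ends beyond all western openings, that
    is if P < c - g, the depth [c - g] is taken instead of P. *)
Lemma closing_west c b s0 sm s1 Ma Mb legs f :
  0 <= c < 50 -> c + b = 100 ->
  line_run (- c) b 100 s0 Ma sm -> line_run (- c) b 100 sm Mb s1 ->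
  pos s1 = - c -> pos sm = b ->
  inside (- c) b (caches s1) ->
  run s1 legs f -> same_point (pos f) base ->
  pos s0 = 0 -> 0 <= food s0 <= 1 -> boxes s0 = [] ->
  1805/4 <= Ma + Mb + miles_walked legs.
Proof.
  intros Hc Hcb R1 R2 Hp1 Hpm Hin Hr Hbase Hp0 Hf0 Hs0.
  destruct (line_run_deepest2 _ _ _ _ _ _ _ _ R1 R2) as (P & HP & Q1 & Q2 & Hatt).
  set (W := 64/3 * b - 720).
  assert (Hturn : forall B m, fair B -> secured east B east_floor sm m ->
                    secured east_home B no_floor sm (m - W)).
  { intros B m HB Hs.
    apply (secured_switch_right east east_home _ east_floor no_floor sm m _ eq_refl);
      [lra| | |exact Hs].
    - intros K. rewrite Hpm. apply east_switch; [lra|]. destruct Hs; lra.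
    - destruct Hs as [Hf _]. unfold W, no_floor, east_floor. lra. }
  assert (Hout : forall P', P <= P' ->
            secured east_home (west P') no_floor s1 (Ma + Mb - W)).
  { intros P' HPP. assert (HP' : 10 <= P') by lra. pose proof (west_fair P' HP').
    pose proof (line_run_mono _ _ _ _ _ _ _ HPP Q1) as Q1'.
    pose proof (line_run_mono _ _ _ _ _ _ _ HPP Q2) as Q2'.
    replace (Ma + Mb - W) with (0 + Ma - W + Mb) by ring.
    apply (secured_line_run _ (west P') _ (- c) b P' sm Mb s1);
      auto using east_home_fair, east_home_floor_ok; try (cbn; lra).
    apply Hturn; trivial.
    apply (secured_line_run _ (west P') _ (- c) b P' s0 Ma sm);
      auto using east_fair, east_floor_ok; try (cbn; lra).
    apply secured_start; auto using east_fair, east_floor_ok. }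
  assert (HH : secured east_home (west_home P) no_floor s1 (Ma + Mb - (4 * P - 40) - W)).
  { pose proof (west_fair P HP) as HW. pose proof (west_home_fair P HP) as HW'.
    pose proof east_fair as HE. pose proof east_home_fair as HE'.
    destruct Hatt as [HP10|[Ho|Ho]].
    - replace (Ma + Mb - (4 * P - 40) - W) with (0 + Ma - W + Mb) by (rewrite HP10; ring).
      apply (secured_line_run _ (west_home P) _ (- c) b P sm Mb s1);
        auto using east_home_floor_ok; try (cbn; lra).
      apply Hturn; trivial.
      apply (secured_line_run _ (west_home P) _ (- c) b P s0 Ma sm);
        auto using east_floor_ok; try (cbn; lra).
      apply secured_start; auto using east_floor_ok.
    - replace (Ma + Mb - (4 * P - 40) - W) with (0 + Ma - (4 * P - 40) - W + Mb) by ring.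
      apply (secured_line_run _ (west_home P) _ (- c) b P sm Mb s1);
        auto using east_home_floor_ok; try (cbn; lra).
      apply Hturn; trivial.
      apply (secured_opens _ _ (- c) b P s0); auto using east_floor_ok; try (cbn; lra).
      apply secured_start; auto using east_floor_ok.
    - replace (Ma + Mb - (4 * P - 40) - W) with (0 + Ma - W + Mb - (4 * P - 40)) by ring.
      apply (secured_opens _ _ (- c) b P sm); auto using east_home_floor_ok; try (cbn; lra).
      apply Hturn; trivial.
      apply (secured_line_run _ (west P) _ (- c) b P s0 Ma sm);
        auto using east_floor_ok; try (cbn; lra).
      apply secured_start; auto using east_floor_ok. }
  assert (Hwl : within_left P s1).
  { eapply (within_left_run _ _ P sm Mb s1); [lra|exact Q2|].
    eapply (within_left_run _ _ P s0 Ma sm); [lra|exact Q1|]. split; [trivial|lra]. }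
  destruct Hwl as [Hf Hwl].
  assert (Hfar : forall k : Z, c <= Rabs (pos s1 - IZR k * 100)).
  { intros k. rewrite Hp1. rewrite <- Rabs_Ropp.
    replace (- (- c - IZR k * 100)) with (c - IZR (- k) * 100) by (rewrite opp_IZR; ring).
    apply circle_distance; lra. }
  pose proof (miles_to_base s1 legs f c Hr Hbase Hfar) as HD.
  set (g := 20 * food s1). assert (Hg : 0 <= g <= 20) by (unfold g; lra).
  destruct (Rle_dec (c - g) P) as [HcP|HcP].
  - pose proof (west_home_fair P HP) as HW'.
    assert (Hnn : forall y, 0 <= price east_home (west_home P) y)
      by (intros; apply price_nonneg; trivial using east_home_fair).
    pose proof (total_nonneg _ (boxes s1) Hnn) as HS0.
    pose proof (fun H => closing_boxes (west_home P) c b s1 legs f HW'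
      (fun x => west_value_ge_mid P x HP) ltac:(lra) Hcb Hp1 Hin Hr Hbase Hf H) as HS.
    destruct HH as (_ & _ & HL). specialize (HL ltac:(lra)).
    rewrite Hp1, Ropp_involutive in HL. rewrite Hp1, Ropp_involutive in Hwl.
    fold g in HL, Hwl, HS.
    set (S := total (price east_home (west_home P)) (boxes s1)) in *.
    destruct (Rle_dec c g) as [Hcg|Hcg].
    { specialize (HL 0 ltac:(cbn; lra) ltac:(rabs)).
      pose proof (value_mono (west_home P) c ((c + 0 + g) / 2) HW' ltac:(lra)).
      rewrite (fair_home _ HW') in HL. unfold W in HL. lra. }
    specialize (HL (c - g) ltac:(cbn; lra) ltac:(rabs)).
    replace ((c + (c - g) + g) / 2) with c in HL by field.
    change (worth (west_home P) (c - g))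
      with (Rmin (- 2 * (c - g)) (40 - 6 * (c - g))) in HL.
    destruct (Rle_dec c (g + 20)) as [Hcg2|Hcg2].
    { destruct (Rmin_cases (- 2 * (c - g)) (40 - 6 * (c - g))) as [[Hm _]|[Hm _]];
        rewrite Hm in HL; unfold W in HL; lra. }
    rewrite Rmin_right in HL by lra.
    specialize (Hwl ltac:(lra)). specialize (HS ltac:(lra)).
    unfold W in HL. replace (160 * food s1) with (8 * g) in HS by (unfold g; ring). lra.
  - assert (HP' : 10 <= c - g) by lra.
    pose proof (west_fair (c - g) HP') as HW'.
    assert (Hnn : forall y, 0 <= price east_home (west (c - g)) y)
      by (intros; apply price_nonneg; trivial using east_home_fair).
    pose proof (total_nonneg _ (boxes s1) Hnn) as HS0.
    pose proof (fun H => closing_boxes (west (c - g)) c b s1 legs f HW'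
      (fun x => west_value_ge_mid (c - g) x HP') ltac:(lra) Hcb Hp1 Hin Hr Hbase Hf H) as HS.
    destruct (Hout (c - g) ltac:(lra)) as (_ & _ & HL). specialize (HL ltac:(lra)).
    rewrite Hp1, Ropp_involutive in HL. rewrite Hp1, Ropp_involutive in Hwl.
    specialize (Hwl ltac:(lra)).
    fold g in HL, Hwl, HS.
    set (S := total (price east_home (west (c - g))) (boxes s1)) in *.
    specialize (HL (c - g) ltac:(cbn; lra) ltac:(rabs)).
    replace ((c + (c - g) + g) / 2) with c in HL by field.
    change (worth (west (c - g)) (c - g)) with (- 2 * (c - g)) in HL.
    unfold W in HL.
    destruct (Rle_dec c (g + 20)) as [Hcg2|Hcg2]; [lra|].
    specialize (HS ltac:(lra)).
    replace (160 * food s1) with (8 * g) in HS by (unfold g; ring). lra.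
Qed.

(** 1805/4 miles are 22 + 9/16 days.  The reflection reduces the four ways of
    closing up to the two above. *)
Lemma lower_bound s legs : exploration s legs -> 1805/4 <= miles_walked legs.
Proof.
  intros (Hs & (f & Hr & Hb) & Hcov).
  set (s0 := State base s false []) in *.
  assert (Hp0 : pos s0 = 0) by reflexivity.
  assert (Hf0 : 0 <= food s0 <= 1) by (cbn; lra).
  assert (Hbx : boxes s0 = []) by reflexivity.
  destruct (closing_split s0 legs f Hr 0 0 Hb) as (lo & hi & sm & s1 & Ma & Mb & legs2
    & I1 & I2 & I3 & R1 & R2 & R3 & HM & Hin & Hend); try lra.
  { constructor. }
  { auto. }
  rewrite HM.
  pose proof (mirror_line_run _ _ _ _ _ _ R1) as R1'.
  pose proof (mirror_line_run _ _ _ _ _ _ R2) as R2'.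
  pose proof (mirror_run _ _ _ R3) as R3'.
  assert (Hb' : same_point (pos (mirror f)) base).
  { replace base with (- base) by (unfold base; ring). apply mirror_same_point, Hb. }
  assert (Hp0' : pos (mirror s0) = 0) by (cbn; unfold base; ring).
  pose proof (mirror_inside _ _ _ Hin) as Hin'.
  assert (Hlo : lo = - - lo) by ring.
  destruct Hend as [[He Hm]|[He Hm]].
  - destruct (Rle_dec 50 hi).
    + rewrite Hlo in R1, R2, Hin.
      apply (closing_east (- lo) hi s0 sm s1 Ma Mb legs2 f); trivial; try lra.
    + rewrite <- (mirror_miles legs2).
      apply (closing_west hi (- lo) (mirror s0) (mirror sm) (mirror s1) Ma Mb _ (mirror f));
        trivial; try lra; cbn; try lra.
      * eapply line_run_mono; [|exact R1']; lra.
      * eapply line_run_mono; [|exact R2']; lra.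
  - destruct (Rle_dec 50 (- lo)).
    + rewrite <- (mirror_miles legs2).
      apply (closing_east hi (- lo) (mirror s0) (mirror sm) (mirror s1) Ma Mb _ (mirror f));
        trivial; try lra; cbn; try lra.
      * eapply line_run_mono; [|exact R1']; lra.
      * eapply line_run_mono; [|exact R2']; lra.
    + rewrite Hlo in R1, R2, Hin.
      apply (closing_west (- lo) hi s0 sm s1 Ma Mb legs2 f); trivial; try lra.
Qed.

(** * An optimal tour *)

Fixpoint legs_through (x : R) (ys : list R) : list (R * R) :=
  match ys with
  | [] => []
  | y :: t => (x, y) :: legs_through y t
  end.

(** In units of 5/4 miles the depots come to be at 5, 5, 7, 8, 8 by the fourth
    return to the base, counted after the first short trip of 1 unit; the other
    points of this stage are 21/2, 11, 14, 16 and 23. *)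
Definition west_stage : list R :=
  [ -5/4; 0; -25/4; -5/4; -5; 0; -35/4; -5; -25/4; 0; -10; 0; -10; 0; -105/8;
    -25/4; -55/4; -105/8; -35/2; -10; -20; -55/4; -35/2; -115/4; -20; 0 ].

(** Five boxes are laid at 10; the units are then 5/8 miles, with stations at 16,
    20, 33 and 50.  From 16 to 50 every walk outwards carries a sealed box and no
    walk back does. *)
Definition east_stage : list R :=
  [ 10; 0; 10; 0; 10; 0; 10; 0; 10; 0; 25/2; 10; 25/2; 10; 20; 10; 165/8; 20;
    165/8; 25/2; 425/16; 165/8; 125/4; 425/16; 125/4; 205/4; 285/4; 365/4; 100 ].

Lemma walk_step x y r r' c l legs f :
  Rabs (y - x) = 20 * (r - r') -> 0 <= r' ->
  run (State y r' c l) legs f -> run (State x r c l) ((x, y) :: legs) f.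
Proof.
  intros Hd Hr' H. pose proof (run_walk x r c l (y - x) legs f) as W.
  unfold miles_per_day in W. replace (x + (y - x)) with y in W by ring.
  apply W; [lra|]. replace (r - Rabs (y - x) / 20) with r' by lra. exact H.
Qed.

Lemma take_first x y l : same_point x y -> take_box x (y :: l) l.
Proof. apply (take_cache x [] y l). Qed.

Lemma take_later x y l l' : take_box x l l' -> take_box x (y :: l) (y :: l').
Proof.
  destruct 1 as [l H|l1 z l2 H]; [apply take_base; exact H|].
  apply (take_cache x (y :: l1) z l2 H).
Qed.

Ltac same :=
  solve [exists 0%Z; unfold base, circumference; lra
        | exists 1%Z; unfold base, circumference; lra].
(** The first box of the list that lies at the walker's point is taken. *)
Ltac take_here :=
  first [apply take_first; same | apply take_later; take_here].
(** The argument is the food left after the walk. *)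
Ltac walk_to r' := apply (walk_step _ _ _ r'); [rabs | lra |].
Ltac load_base := eapply run_handle; [apply pick_up, take_base; same|].
Ltac open_base := eapply run_handle; [apply open_lying, take_base; same|].
Ltac load := eapply run_handle; [apply pick_up; take_here|].
Ltac open_box := eapply run_handle; [apply open_lying; take_here|].
Ltac open_carried_box := eapply run_handle; [apply open_carried|].
Ltac unload := eapply run_handle; [apply drop|].

Lemma west_depots legs f :
  run (State base 0 false [-115/4; -35/4]) legs f ->
  run (State base (1/8) false []) (legs_through base west_stage ++ legs) f.
Proof.
  intros H. cbn. change base with 0 in *.
  load_base. walk_to (1/16). unload. walk_to 0.
  open_base. load_base. walk_to (11/16). unload. walk_to (7/16). load.
    walk_to (1/4). unload. walk_to 0.
  open_base. load_base. walk_to (9/16). unload. walk_to (3/8). load.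
    walk_to (5/16). unload. walk_to 0.
  open_base. load_base. walk_to (1/2). unload. walk_to 0.
  open_base. load_base. walk_to (1/2). unload. walk_to 0.
  open_base. load_base. walk_to (11/32). unload. walk_to 0.
  open_box. load. walk_to (5/8). unload. walk_to (19/32). load. walk_to (3/8).
    unload. walk_to 0.
  open_box. load. walk_to (1/2). unload. walk_to (3/16). load. walk_to 0.
  open_box. walk_to (7/16). unload. walk_to 0.
  open_box. walk_to 0.
  exact H.
Qed.

Lemma east_crossing :
  run (State base 0 false [-115/4; -35/4]) (legs_through base east_stage)
      (State 100 (9/16) false []).
Proof.
  cbn. change base with 0.
  open_base. load_base. walk_to (1/2). unload. walk_to 0.
  open_base. load_base. walk_to (1/2). unload. walk_to 0.
  open_base. load_base. walk_to (1/2). unload. walk_to 0.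
  open_base. load_base. walk_to (1/2). unload. walk_to 0.
  open_base. load_base. walk_to (1/2). unload. walk_to 0.
  open_base. load_base. walk_to (3/8). unload. walk_to (1/4). load. walk_to (1/8).
    unload. walk_to 0.
  open_box. load. walk_to (1/2). unload. walk_to 0.
  open_box. load. walk_to (15/32). unload. walk_to (7/16). load. walk_to (13/32).
    unload. walk_to 0.
  open_box. load. walk_to (19/64). unload. walk_to 0.
  open_box. load. walk_to (15/32). unload. walk_to (15/64). load. walk_to 0.
  open_box. walk_to 0.
  open_carried_box. walk_to 0.
  open_box. walk_to 0.
  open_box. walk_to (9/16).
  apply run_stop.
Qed.

Definition tour : list (R * R) :=
  legs_through base west_stage ++ legs_through base east_stage.

Lemma tour_duration : duration tour = 22 + 9/16.
Proof.
  unfold duration, miles_walked, miles_per_day, tour; cbn. change base with 0.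
  repeat match goal with
  | |- context [Rabs ?a] =>
      first [rewrite (Rabs_pos_eq a) by lra | rewrite (Rabs_left1 a) by lra]
  end.
  lra.
Qed.

Ltac in_tour :=
  unfold tour; apply in_or_app; right; cbn; change base with 0; auto 40.

Lemma tour_visits p : visits tour p.
Proof.
  assert (Hleg : forall a b q, In (a, b) tour -> a <= q <= b -> same_point q p ->
                   visits tour p).
  { intros a b q Hin Hq Hp. exists a, b, q. split; [exact Hin|split; [|exact Hp]].
    rewrite Rmin_left, Rmax_right by lra. exact Hq. }
  set (k := Int_part (p / 100)).
  assert (Hk : 0 <= p - IZR k * 100 < 100).
  { destruct (base_Int_part (p / 100)) as [H1 H2]. fold k in H1, H2. lra. }
  assert (Hs : same_point (p - IZR k * 100) p).
  { exists (- k)%Z. unfold circumference. rewrite opp_IZR. ring. }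
  set (q := p - IZR k * 100) in *. clearbody q.
  destruct (Rle_dec q 10); [apply (Hleg 0 10 q); [in_tour | lra | exact Hs]|].
  destruct (Rle_dec q 20); [apply (Hleg 10 20 q); [in_tour | lra | exact Hs]|].
  destruct (Rle_dec q (165/8)); [apply (Hleg 20 (165/8) q); [in_tour | lra | exact Hs]|].
  destruct (Rle_dec q (125/4)); [apply (Hleg (165/8) (125/4) q); [in_tour | lra | exact Hs]|].
  destruct (Rle_dec q (205/4)); [apply (Hleg (125/4) (205/4) q); [in_tour | lra | exact Hs]|].
  destruct (Rle_dec q (285/4)); [apply (Hleg (205/4) (285/4) q); [in_tour | lra | exact Hs]|].
  destruct (Rle_dec q (365/4)); [apply (Hleg (285/4) (365/4) q); [in_tour | lra | exact Hs]|].
  apply (Hleg (365/4) 100 q); [in_tour | lra | exact Hs].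
Qed.

Theorem mainTheorem1 :
  (exists (s : R) (legs : list (R * R)),
     exploration s legs /\ duration legs = 22 + 9 / 16) /\
  (forall (s : R) (legs : list (R * R)),
     exploration s legs -> 22 + 9 / 16 <= duration legs).
Proof.
  split.
  - exists (1/8), tour. split; [|exact tour_duration].
    split; [lra|split; [|exact tour_visits]].
    exists (State 100 (9/16) false []). split.
    + apply west_depots, east_crossing.
    + exists 1%Z. cbn. unfold base, circumference. ring.
  - intros s legs H. pose proof (lower_bound s legs H).
    unfold duration, miles_per_day. lra.
Qed.
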